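(* Let $P_q(y|x)$ be the channel between the clean query result $x\in\{0,1\}$ and the observed query output $y$ for a query region of size $q$, satisfying the standing assumptions listed in the context. Consider the search problem for a stationary target on $[0,1)$ described in the context. For non-adaptive search strategies, the maximal targeting rate is given by $$\max_{q\in(0,\frac12)} I_{XY}(q,q),$$ where $I_{XY}(q,q)$ is the mutual information between a binary random variable $X$ with $\Pr(X=1)=q$ and the output $Y$ of the channel $P_q(y|x)$ with input $X$. Moreover, for any $R$ below the maximal targeting rate, there exists a non-adaptive search strategy (with number of queries $\tau$, resolution $\delta$ and error probability $\varepsilon$) such that $$\tau=\frac{\log(1/\delta)}{R},\qquad \log(1/\varepsilon)=\frac{E_r(R,q^* )}{R}\cdot\log(1/\delta),$$ where $q^*$ is the maximizer of $I_{XY}(q,q)$ over $q\in(0,\frac12)$, and $$E_r(R,q^* )=\max_{\rho\in(0,1)}\big[E_0(\rho,q^* )-\rho R\big]$$ is the random coding exponent for the channel $P_{q^*}(y|x)$ with input distribution $q^*$ (that is, $\Pr(X=1)=q^*$), at rate $R$. Here $$E_0(\rho,q^* )=-\log\int_{\mathcal Y}\Big\{q^*P_{q^*}(y|1)^{\frac1{1+\rho}}+(1-q^* )P_{q^*}(y|0)^{\frac1{1+\rho}}\Big\}^{1+\rho}dy.$$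
   Context: All logarithms are to base 2. Search model. A target sits at an arbitrary unknown point $w\in[0,1)$. At each time $n=1,2,\dots$ an agent chooses (possibly at random) a measurable query set $S_n\subset[0,1)$; let $q_n=|S_n|$ be its Lebesgue measure and $X_n=\mathbf 1(w\in S_n)$. The agent observes $Y_n\in\mathcal Y$ ($\mathcal Y$ discrete or continuous), where, given $X_n=x_n$ and $|S_n|=q_n$, $Y_n$ is drawn from $P_{q_n}(\cdot|x_n)$ (memoryless observation channel). Here $P_q(\cdot|x)$ denotes a probability mass function or density (integrals over $\mathcal Y$ are sums in the discrete case). Channel quantities. $I_{XY}(p,q)$ is the mutual information between a binary $X$ with $\Pr(X=1)=p$ and the output $Y$ of $P_q(y|x)$. $C(q)=\max_p I_{XY}(p,q)$. $C_1(q)=D(P_q(\cdot|1)\,\|\,P_q(\cdot|0))$ (KL divergence). Standing assumptions. $P_q(y|x)$ is continuous in $q$ for $0\le q\le1$; $C_1(q)<\infty$; and for $q_1<q_2$, $C(q_1)\ge C(q_2)$ and $C_1(q_1)\ge C_1(q_2)$. Strategies. A search strategy is a causal protocol for choosing $S_n=S_n(Y^{n-1})$ (possibly randomized, with the agent knowing the randomness it used), a stopping time $\tau$, and an estimator $\widehat W_\tau=\widehat W_\tau(Y^\tau)$. It is non-adaptive if the choice of $S_n$ is independent of $Y^{n-1}$; in that case $\tau$ is fixed in advance. A strategy has resolution $\delta$ and error probability $\varepsilon$ if $\Pr(|\widehat W_\tau-w|\le\delta)\ge1-\varepsilon$ for every $w$. Maximal targeting rate. For a class of strategies, this is the maximal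 ratio $\frac{\log(1/\delta)}{\mathbb E(\tau)}$ such that $\varepsilon\to0$ is possible as $\delta\to0$.
   Formalization: Equality of the rate with the maximum is stated only if I(q,q) for 1/2<q<1 never exceeds its supremum over (0,1/2), as it fails otherwise; the maximum, which may not be attained, is a supremum; the ''moreover'' part is for R>0, any maximizer q*, and small δ with log(1/δ)/R an integer. *)

(* Defs.v *)
From HB Require Import structures.
From mathcomp Require Import all_boot all_order all_algebra.
From mathcomp Require Import all_classical all_reals all_analysis.
Set Implicit Arguments.
Unset Strict Implicit.
Unset Printing Implicit Defensive.
Import Order.TTheory GRing.Theory Num.Theory.
Import numFieldNormedType.Exports.
Local Open Scope classical_set_scope.
Local Open Scope ring_scope.

Definition log2 {R : realType} (x : R) : R := ln x / ln 2.

(* Integrand of a divergence, with 0 log (0 / b) = 0 and a log (a / 0) = +oo. *)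
Definition kl_term {R : realType} (a b : R) : \bar R :=
  if a == 0 then 0%E
  else if b == 0 then +oo%E
  else (a * log2 (a / b))%:E.

Section channel.
Context {R : realType} {d : measure_display} {Y : measurableType d}.
Variable mu : {measure set Y -> \bar R}.

(* D(f || g) for densities f, g with respect to mu. *)
Definition KL (f g : Y -> R) : \bar R := (\int[mu]_y kl_term (f y) (g y))%E.

(* The channel is a function W of the query size q, the input bit x and the
   output y: W q x y is the density P_q(y|x) with respect to mu.  Taking mu to
   be a counting measure gives mass functions, and the Lebesgue measure gives
   densities in the usual sense. *)
Definition is_channel (W : R -> bool -> Y -> R) : Prop :=
  forall q x, 0 <= q <= 1 ->
    [/\ measurable_fun setT (W q x),
        forall y, 0 <= W q x y
      & (\int[mu]_y (W q x y)%:E)%E = 1%E].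

Variable W : R -> bool -> Y -> R.

Definition input_pmf (p : R) (x : bool) : R := if x then p else 1 - p.

Definition output_density (p q : R) (y : Y) : R :=
  \sum_(x : bool) input_pmf p x * W q x y.

(* I_XY(p, q) = D(P_XY || P_X P_Y), with Pr(X = 1) = p and channel P_q. *)
Definition mutual_info (p q : R) : \bar R :=
  (\sum_(x : bool) \int[mu]_y
     kl_term (input_pmf p x * W q x y)%R
             (input_pmf p x * output_density p q y)%R)%E.

Definition capacity (q : R) : \bar R :=
  ereal_sup [set mutual_info p q | p in `[0, 1]].

Definition C1 (q : R) : \bar R := KL (W q true) (W q false).

Definition E0 (rho q : R) : R :=
  - log2 (\int[mu]_y
     ((q * W q true y `^ (1 + rho)^-1
       + (1 - q) * W q false y `^ (1 + rho)^-1) `^ (1 + rho))).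

(* A supremum: over the open interval it need not be attained, since the
   optimal rho tends to 1 at low rates. *)
Definition Er (r q : R) : R :=
  sup [set E0 rho q - rho * r | rho in `]0, 1[].

End channel.

(* The agent's private randomness u is drawn once from rand_law and is known to
   the estimator; the queries depend on it but not on the observations, and the
   number of queries is fixed in advance. *)
Record nonadaptive_strategy (R : realType) (d : measure_display)
    (Y : measurableType d) := NonadaptiveStrategy {
  nqueries : nat;
  rand_disp : measure_display;
  rand : measurableType rand_disp;
  rand_law : probability rand R;
  query : 'I_nqueries -> rand -> set R;
  query_sub : forall i u, query i u `<=` `[0, 1[;
  query_measurable : forall i,
    measurable [set uw : rand * measurableTypeR R | query i uw.1 uw.2];
  estimator : rand -> nqueries.-tuple Y -> R;
  estimator_measurable :
    measurable_fun setT
      (fun uy : rand * nqueries.-tuple Y => estimator uy.1 uy.2)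
}.

Section search.
Context {R : realType} {d : measure_display} {Y : measurableType d}.
Variable mu : {measure set Y -> \bar R}.

(* Probability that (Y_1, ..., Y_n) lies in A when the Y_i are independent and
   Y_i has density f i. *)
Fixpoint memoryless_prob (n : nat) :
    ('I_n -> Y -> R) -> set (n.-tuple Y) -> \bar R :=
  match n with
  | 0 => fun _ A => (\1_A [tuple])%:E
  | m.+1 => fun f A =>
      (\int[mu]_y ((f ord0 y)%:E *
         memoryless_prob (fun i => f (lift ord0 i))
           [set t : m.-tuple Y | A [tuple of y :: t]]))%E
  end.

Variable W : R -> bool -> Y -> R.

Definition query_size (s : nonadaptive_strategy R Y) (i : 'I_(nqueries s))
    (u : rand s) : R := fine (lebesgue_measure (query i u)).

Definition success_prob (s : nonadaptive_strategy R Y) (delta w : R) :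
    \bar R :=
  (\int[rand_law s]_u
     memoryless_prob (fun i => W (query_size i u) (w \in query i u))
       [set y | (`|estimator u y - w| <= delta)%R])%E.

Definition has_resolution (s : nonadaptive_strategy R Y) (delta eps : R) :
    Prop :=
  forall w, 0 <= w < 1 -> ((1 - eps)%:E <= success_prob s delta w)%E.

Definition achievable_rate (r : R) : Prop :=
  exists (s : nat -> nonadaptive_strategy R Y) (delta eps : nat -> R),
    [/\ forall k, [/\ (0 < nqueries (s k))%N, 0 < delta k,
                      has_resolution (s k) (delta k) (eps k)
                    & r <= log2 (delta k)^-1 / (nqueries (s k))%:R],
        delta k @[k --> \oo] --> 0
      & eps k @[k --> \oo] --> 0].

(* The maximal targeting rate of non-adaptive strategies; it is 0 when reliable
   search at vanishing resolution is impossible. *)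
Definition max_nonadaptive_rate : \bar R :=
  ereal_sup (0%E |` [set r%:E | r in achievable_rate]).

End search.

(* Main.v *)
(* Converse.  Fix the private randomness and the target w.  By the
   Donsker-Varadhan inequality, applied letter by letter with the function
   T 1[hit], the success probability p(w) satisfies
     T p(w) <= sum_i D(P_(q_i)(.|x_i(w)) || output law of query i)
               + (e^T - 1) * (output-law probability of hitting w).
   Averaging over a uniform w turns the divergences into I(q_i, q_i) and the last
   probability into the length 2 delta of the window around the estimate; then
   take T = ln (1 / (2 delta)).  The boundary sizes q = 0, 1/2, 1 follow by lower
   semicontinuity (Fatou).

   Achievability.  Random coding over M cells, M about 3/(4 delta), with maximum
   likelihood decoding and Gallager's bound.  The exponent must hold without any
   o(n) loss, so every query must have measure exactly q.  The cells are therefore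
   split into two groups of N with slightly different lengths, and each query
   takes a uniformly random set of a prescribed number of cells in each group.
   This makes two cells only nearly independent, which costs a factor
   (1 + O(1/N))^n = 1 + o(1); cells may be as long as 2 delta, so there are only
   (4/5)/delta competitors, and the factor (4/5)^rho absorbs that loss.  That
   rates below I(q, q) have a positive exponent is Fatou's lemma applied to the
   difference quotient of the Gallager integrand at rho = 0. *)

Require Import Defs.
From HB Require Import structures.
From mathcomp Require Import all_boot all_order all_algebra fingroup perm.
From mathcomp Require Import all_classical all_reals all_analysis.
From mathcomp Require Import measurable_realfun ring lra.
Import Order.TTheory GRing.Theory Num.Theory.
Import numFieldNormedType.Exports.
Local Open Scope classical_set_scope.
Local Open Scope ring_scope.
Set Implicit Arguments.
Unset Strict Implicit.
Unset Printing Implicit Defensive.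

(** * Product measure on tuples *)

(** Donsker-Varadhan is used in place of Fano's inequality because it asks neither for a finite
    message set nor for finite divergences: the test function is bounded, and every comparison is
    between integrals of nonnegative functions, so Tonelli suffices even where a divergence is
    infinite.

    For the random code, Jensen's inequality conditionally on the sent codeword is replaced by
    Young's inequality, which linearises [x ^ rho], so that only sums over pairs of cells have to be
    controlled.

    The gain [(4/5) ^ rho] is of use only if [rho] stays away from 0. The bound
    [E0 <= rho * log (1 / min (q, 1 - q))] forces this for near-optimal [rho] when the exponent is
    positive. The gain then pays for two losses: the dependence between cells, and a supremum over
    [rho] that need not be attained.

    The converse meets queries of every size in [0, 1], so the supremum over (0, 1/2) governs it
    once sizes above 1/2 are known not to exceed that supremum. *)

Section tuple_measure.
Context {R : realType} {d : measure_display} {Y : measurableType d}.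
Variable mu : {sigma_finite_measure set Y -> \bar R}.

Definition tcons n (p : Y * n.-tuple Y) : n.+1.-tuple Y :=
  [tuple of p.1 :: p.2].

Lemma measurable_tcons n : measurable_fun setT (@tcons n).
Proof. exact: measurable_cons. Qed.

Section step.
Variables (n : nat) (nu : {sigma_finite_measure set (n.-tuple Y) -> \bar R}).

Definition cons_measure := pushforward (mu \x nu)%E (@tcons n).

Let cm0 : cons_measure set0 = 0%E.
Proof. by rewrite /cons_measure /pushforward preimage_set0 measure0. Qed.

Let cm_ge0 A : (0 <= cons_measure A)%E.
Proof. by rewrite /cons_measure /pushforward; exact: measure_ge0. Qed.

Let cm_sigma_additive : semi_sigma_additive cons_measure.
Proof.
pose m := measure_function_pushforward__canonical__measure_function_Measure
  (mu \x nu)%E (@measurable_tcons n).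
exact: (@measure_semi_sigma_additive _ _ _ m).
Qed.

HB.instance Definition _ := isMeasure.Build _ _ _ cons_measure
  cm0 cm_ge0 cm_sigma_additive.

Let cm_sigma_finite : sigma_finite setT cons_measure.
Proof.
have /sigma_finiteP[F [FT ndF mF]] := sigma_finiteT mu.
have /sigma_finiteP[G [GT ndG mG]] := sigma_finiteT nu.
pose uncons (t : n.+1.-tuple Y) := (thead t, [tuple of behead t] : n.-tuple Y).
have consK : uncons \o @tcons n = id.
  by apply/funext => -[y t]; congr pair; exact/val_inj.
have muncons : measurable_fun setT uncons.
  by apply/measurable_fun_pair; [exact: measurable_tnth|exact: measurable_behead].
exists (fun k => uncons @^-1` (F k `*` G k)).
  rewrite -preimage_bigcup; apply/esym/seteqP; split => // t _ /=.
  have [k _ Fk] : (\bigcup_k F k) (thead t) by rewrite -FT.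
  have [l _ Gl] : (\bigcup_k G k) [tuple of behead t] by rewrite -GT.
  (* Both covers are increasing, so the larger index serves both coordinates. *)
  exists (maxn k l) => //; split => /=.
    by move: Fk; exact/subsetPset/ndF/leq_maxl.
  by move: Gl; exact/subsetPset/ndG/leq_maxr.
move=> k; have [mFk Fk] := mF k; have [mGk Gk] := mG k; split.
  by rewrite -[X in measurable X]setTI; apply: muncons => //; exact: measurableX.
rewrite /cons_measure /pushforward -comp_preimage consK preimage_id.
by rewrite product_measure1E// lte_mul_pinfty// ge0_fin_numE.
Qed.

HB.instance Definition _ := Measure_isSigmaFinite.Build _ _ _ cons_measure cm_sigma_finite.

End step.

(** The iterated integrals of [memoryless_prob] become integrals against this one measure. The
    recursion returns a sigma-finite measure because the next product and Tonelli both require it;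
    the point mass in dimension 0 makes empty products integrate to 1. *)
Fixpoint tuple_measure n : {sigma_finite_measure set (n.-tuple Y) -> \bar R} :=
  match n with
  | 0 => \d_([tuple] : 0.-tuple Y)
  | m.+1 => cons_measure (tuple_measure m)
  end.

Local Open Scope ereal_scope.

Lemma integral_tuple0 (F : 0.-tuple Y -> \bar R) :
  measurable_fun setT F -> \int[tuple_measure 0]_t F t = F [tuple].
Proof. by move=> mF; rewrite /= integral_dirac// diracE in_setT mul1e. Qed.

Lemma integral_tupleS n (F : n.+1.-tuple Y -> \bar R) :
  measurable_fun setT F -> (forall t, 0 <= F t) ->
  \int[tuple_measure n.+1]_t F t =
  \int[mu]_y \int[tuple_measure n]_t F [tuple of y :: t].
Proof.
move=> mF F0.
transitivity (\int[mu \x tuple_measure n]_p F (tcons p)).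
  rewrite -[RHS](ge0_integral_pushforward (@measurable_tcons n)
    (mu \x tuple_measure n) (D := setT))//.
rewrite fubini_tonelli1//=.
by apply: (measurableT_comp mF); exact: measurable_tcons.
Qed.

Lemma measurable_prod_tnth n (f : 'I_n -> Y -> R) :
  (forall i, measurable_fun setT (f i)) ->
  measurable_fun setT (fun t : n.-tuple Y => \prod_(i < n) f i (tnth t i))%R.
Proof.
move=> mf; apply: measurable_prod => i _.
by apply: (measurableT_comp (mf i)); exact: measurable_tnth.
Qed.

Lemma integral_tuple_prod n (f : 'I_n -> Y -> R) :
  (forall i, measurable_fun setT (f i)) -> (forall i y, (0 <= f i y)%R) ->
  \int[tuple_measure n]_t (\prod_(i < n) f i (tnth t i))%:E =
  \prod_(i < n) \int[mu]_y (f i y)%:E.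
Proof.
elim: n f => [|n IH] f mf f0.
  rewrite integral_tuple0 ?big_ord0//.
  by apply/measurable_EFinP; exact: measurable_prod_tnth.
rewrite integral_tupleS; last 2 first.
- by apply/measurable_EFinP; exact: measurable_prod_tnth.
- by move=> t; rewrite lee_fin prodr_ge0.
rewrite big_ord_recl -IH//=.
rewrite -ge0_integralZr//; last 3 first.
- by apply/measurable_EFinP; exact: mf.
- by move=> y _; rewrite lee_fin.
- by apply: integral_ge0 => t _; rewrite lee_fin prodr_ge0.
apply: eq_integral => y _.
rewrite -ge0_integralZl//.
- apply: eq_integral => t _; rewrite big_ord_recl/= EFinM; congr (_ * _).
  congr EFin; apply: eq_bigr => i _; congr f.
  by rewrite (tnth_nth y)/= -tnth_nth.
- apply/measurable_EFinP.
  exact: (@measurable_prod_tnth n (fun i => f (lift ord0 i))).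
- by move=> t _; rewrite lee_fin prodr_ge0.
- by rewrite lee_fin.
Qed.

End tuple_measure.

(** * Memoryless laws as densities; the Donsker-Varadhan inequality *)

Section memoryless.
Context {R : realType} {d : measure_display} {Y : measurableType d}.
Variable mu : {sigma_finite_measure set Y -> \bar R}.
Local Open Scope ereal_scope.

Definition tuple_density n (f : 'I_n -> Y -> R) (t : n.-tuple Y) : R :=
  (\prod_(i < n) f i (tnth t i))%R.

Lemma tuple_density_ge0 n (f : 'I_n -> Y -> R) t :
  (forall i y, (0 <= f i y)%R) -> (0 <= tuple_density f t)%R.
Proof. by move=> f0; exact: prodr_ge0. Qed.

Lemma tuple_density_cons n (f : 'I_n.+1 -> Y -> R) y (t : n.-tuple Y) :
  tuple_density f [tuple of y :: t] =
  (f ord0 y * tuple_density (fun i => f (lift ord0 i)) t)%R.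
Proof.
rewrite /tuple_density big_ord_recl/=; congr (_ * _)%R.
by apply: eq_bigr => i _; congr f; rewrite (tnth_nth y)/= -tnth_nth.
Qed.

Lemma measurable_tuple_density n (f : 'I_n -> Y -> R) :
  (forall i, measurable_fun setT (f i)) ->
  measurable_fun setT (tuple_density f).
Proof. exact: measurable_prod_tnth. Qed.

Lemma measurable_cons_section n (y : Y) :
  measurable_fun setT (fun t : n.-tuple Y => [tuple of y :: t]).
Proof. by apply: measurable_cons => //; exact: measurable_cst. Qed.

(** Links the iterated integrals of the model to a single density, for which the order of
    integration can be changed. Measurability of [A] passes to its sections at a fixed first
    letter. *)
Lemma memoryless_probE n (f : 'I_n -> Y -> R) (A : set (n.-tuple Y)) :
  (forall i, measurable_fun setT (f i)) -> (forall i y, (0 <= f i y)%R) ->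
  measurable A ->
  memoryless_prob mu f A =
  \int[tuple_measure mu n]_t (tuple_density f t * \1_A t)%:E.
Proof.
elim: n f A => [|n IH] f A mf f0 mA.
  rewrite integral_tuple0 /tuple_density ?big_ord0 ?mul1r//.
  apply/measurable_EFinP/measurable_funM; first exact: measurable_tuple_density.
  exact: measurable_indic.
rewrite integral_tupleS; last 2 first.
- apply/measurable_EFinP/measurable_funM; first exact: measurable_tuple_density.
  exact: measurable_indic.
- by move=> t; rewrite lee_fin mulr_ge0// tuple_density_ge0.
rewrite /=; apply: eq_integral => y _.
have mAy : measurable [set t : n.-tuple Y | A [tuple of y :: t]].
  by rewrite -[X in measurable X]setTI; exact: measurable_cons_section.
have mf' i : measurable_fun setT (f (lift ord0 i)) by exact: mf.
rewrite IH// -ge0_integralZl//; last 3 first.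
- apply/measurable_EFinP/measurable_funM; first exact: measurable_tuple_density.
  exact: measurable_indic.
- by move=> t _; rewrite lee_fin mulr_ge0// tuple_density_ge0.
- by rewrite lee_fin.
apply: eq_integral => t _; rewrite tuple_density_cons -EFinM mulrA.
by rewrite !indicE; congr (_ * _)%:E%R; rewrite !mem_setE.
Qed.

(* Integrand of the divergence in nats; the term [b - a], which integrates to 0
   for densities, makes it nonnegative. *)
Definition phi (a b : R) : \bar R :=
  if a == 0%R then b%:E else if b == 0%R then +oo
  else (a * (ln a - ln b) - a + b)%:E.

(** Fenchel-Young: [b * (expR t - 1)] is the convex conjugate of [phi _ b]. It is [1 + x <= expR x]
    at [x = t - ln (a / b)], multiplied by [a]. *)
Lemma phi_young (a b t : R) : (0 <= a)%R -> (0 <= b)%R ->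
  (a * t + b)%:E <= phi a b + (b * expR t)%:E.
Proof.
rewrite /phi => a0 b0; have [->|an0] := eqVneq a 0%R.
  by rewrite mul0r add0r -EFinD lee_fin lerDl mulr_ge0// expR_ge0.
have [->|bn0] := eqVneq b 0%R; first by rewrite mul0r addr0 addye// leey.
have {an0}a0 : (0 < a)%R by rewrite lt_neqAle eq_sym an0.
have {bn0}b0 : (0 < b)%R by rewrite lt_neqAle eq_sym bn0.
rewrite -EFinD lee_fin.
have := expR_ge1Dx (t - (ln a - ln b)).
have -> : (expR (t - (ln a - ln b)) = b * expR t / a)%R.
  by rewrite !expRB !lnK ?posrE//; field; rewrite !gt_eqF.
move=> /(ler_wpM2l (ltW a0)).
suff -> : (a * (b * expR t / a) = b * expR t)%R by lra.
by field; rewrite gt_eqF.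
Qed.

Lemma phi_ge0 (a b : R) : (0 <= a)%R -> (0 <= b)%R -> 0 <= phi a b.
Proof.
move=> a0 b0; have := phi_young 0%R a0 b0.
by rewrite mulr0 add0r expR0 mulr1 -{1}[b%:E]add0e leeD2rE.
Qed.

Lemma measurable_phi (f g : Y -> R) :
  measurable_fun setT f -> measurable_fun setT g ->
  measurable_fun setT (fun y => phi (f y) (g y)).
Proof.
move=> mf mg; apply: measurable_fun_ifT => /=.
- exact: measurable_fun_eqr.
- by apply/measurable_EFinP.
- apply: measurable_fun_ifT => /=.
  + exact: measurable_fun_eqr.
  + exact: measurable_cst.
  + apply/measurable_EFinP/measurable_funD => //.
    apply/measurable_funB => //; apply/measurable_funM => //.
    by apply/measurable_funB; apply: measurableT_comp => //;
      exact: measurable_ln.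
Qed.

(* [phi_young] at [t = F - ln (\int g e^F)], integrated. *)
Lemma donsker_varadhan (f g F : Y -> R) (T : R) :
  measurable_fun setT f -> measurable_fun setT g -> measurable_fun setT F ->
  (forall y, 0 <= f y)%R -> (forall y, 0 <= g y)%R ->
  (forall y, 0 <= F y <= T)%R ->
  \int[mu]_y (f y)%:E = 1 -> \int[mu]_y (g y)%:E = 1 ->
  \int[mu]_y (f y * F y)%:E <=
  \int[mu]_y phi (f y) (g y) + (ln (fine (\int[mu]_y (g y * expR (F y))%:E)))%:E.
Proof.
move=> mf mg mF f0 g0 F0 f1 g1.
set Z := \int[mu]_y (g y * expR (F y))%:E.
have mgF : measurable_fun setT (fun y => (g y * expR (F y))%:E).
  by apply/measurable_EFinP/measurable_funM => //; exact: measurableT_comp.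
have gF0 y : 0 <= (g y * expR (F y))%:E by rewrite lee_fin mulr_ge0// expR_ge0.
have Z1 : 1 <= Z.
  rewrite -g1; apply: ge0_le_integral => //.
  - by move=> y _; rewrite lee_fin.
  - by apply/measurable_EFinP.
  - by move=> y _; rewrite lee_fin ler_peMr// -expR0 ler_expR; case/andP: (F0 y).
have ZT : Z <= (expR T)%:E.
  rewrite -[leRHS]mule1 -g1 -ge0_integralZl//; last 2 first.
  - by apply/measurable_EFinP.
  - by move=> y _; rewrite lee_fin.
  apply: ge0_le_integral => //.
  - by apply/measurable_EFinP/measurable_funM.
  - move=> y _; rewrite -EFinM lee_fin mulrC ler_wpM2r// ler_expR.
    by case/andP: (F0 y).
have Zfin : Z \is a fin_num.
  rewrite ge0_fin_numE ?(le_trans _ Z1)//.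
  by rewrite (le_lt_trans ZT)// ltry.
have fZ1 : (1 <= fine Z)%R by rewrite -lee_fin fineK.
set V := ln (fine Z).
have V0 : (0 <= V)%R by exact: ln_ge0.
have eV : expR V = fine Z by rewrite lnK// posrE (lt_le_trans _ fZ1).
(* The terms are distributed so that both sides are nonnegative ([F >= 0] gives [V >= 0]); they can
   then be integrated termwise although the divergence may be infinite. After integration a 1
   cancels on each side. *)
pose L y := (f y * F y)%:E + (g y)%:E.
pose Rr y := phi (f y) (g y) + ((expR V)^-1%:E * (g y * expR (F y))%:E + V%:E * (f y)%:E).
have pw y : L y <= Rr y.
  rewrite /L /Rr.
  have := phi_young (F y - V) (f0 y) (g0 y).
  have -> : (f y * F y)%:E + (g y)%:E =
      (f y * (F y - V) + g y)%:E + (V * f y)%:E.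
    by rewrite -!EFinD; congr EFin; ring.
  rewrite addeA leeD2rE// expRB -EFinM => /le_trans; apply.
  by rewrite (_ : _^-1 * _ = g y * (expR (F y) / expR V))%R//; ring.
have mphi := measurable_phi mf mg.
have phi0 y : 0 <= phi (f y) (g y) by exact: phi_ge0.
have eV0 : (0 < expR V)%R by exact: expR_gt0.
have : \int[mu]_y L y <= \int[mu]_y Rr y.
  apply: ge0_le_integral => //.
  - by move=> y _; rewrite /L -EFinD lee_fin addr_ge0// mulr_ge0//; case/andP: (F0 y).
  - by apply/emeasurable_funD; apply/measurable_EFinP => //; exact/measurable_funM.
  - apply/emeasurable_funD => //; apply/emeasurable_funD.
      exact/measurable_funeM.
    by apply/measurable_funeM/measurable_EFinP.
rewrite /L /Rr ge0_integralD//; last 4 first.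
- by move=> y _; rewrite lee_fin mulr_ge0//; case/andP: (F0 y).
- by apply/measurable_EFinP/measurable_funM.
- by move=> y _; rewrite lee_fin.
- by apply/measurable_EFinP.
rewrite ge0_integralD//; last 2 first.
- move=> y _; rewrite adde_ge0// ?mule_ge0// ?lee_fin// invr_ge0; exact: ltW.
- apply/emeasurable_funD; first exact/measurable_funeM.
  by apply/measurable_funeM/measurable_EFinP.
rewrite ge0_integralD//; last 4 first.
- by move=> y _; rewrite mule_ge0// lee_fin invr_ge0; exact: ltW.
- exact/measurable_funeM.
- by move=> y _; rewrite mule_ge0// lee_fin.
- by apply/measurable_funeM/measurable_EFinP.
rewrite !ge0_integralZl//; last 2 first.
- by apply/measurable_EFinP.
- by move=> y _; rewrite lee_fin.
rewrite f1 g1 -/Z mule1 eV -(fineK Zfin) -EFinM /= mulVf; last first.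
  by rewrite gt_eqF// (lt_le_trans _ fZ1).
rewrite [1 + V%:E]addeC addeA leeD2rE//.
Qed.

Lemma integral_tuple_density n (f : 'I_n -> Y -> R) :
  (forall i, measurable_fun setT (f i)) -> (forall i y, 0 <= f i y)%R ->
  (forall i, \int[mu]_y (f i y)%:E = 1) ->
  \int[tuple_measure mu n]_t (tuple_density f t)%:E = 1.
Proof. by move=> mf f0 f1; rewrite integral_tuple_prod// big1. Qed.

(** Induction on the letters. Given the first letter, the inequality for the tail produces a
    log-partition function [V], which then serves as test function for the first letter. Since
    [expR (V y)] is exactly the inner integral, nothing is lost and no chain rule for divergences is
    used. *)
Lemma donsker_varadhan_tuple n (f g : 'I_n -> Y -> R) (F : n.-tuple Y -> R)
    (T : R) :
  (forall i, measurable_fun setT (f i)) ->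
  (forall i, measurable_fun setT (g i)) -> measurable_fun setT F ->
  (forall i y, 0 <= f i y)%R -> (forall i y, 0 <= g i y)%R ->
  (forall t, 0 <= F t <= T)%R ->
  (forall i, \int[mu]_y (f i y)%:E = 1) ->
  (forall i, \int[mu]_y (g i y)%:E = 1) ->
  \int[tuple_measure mu n]_t (tuple_density f t * F t)%:E <=
  \sum_(i < n) \int[mu]_y phi (f i y) (g i y) +
  (ln (fine (\int[tuple_measure mu n]_t
               (tuple_density g t * expR (F t))%:E)))%:E.
Proof.
elim: n f g F => [|n IH] f g F mf mg mF f0 g0 F0 f1 g1.
  rewrite !integral_tuple0/=; last 2 first.
  - apply/measurable_EFinP/measurable_funM; last exact: measurableT_comp.
    exact: measurable_tuple_density.
  - apply/measurable_EFinP/measurable_funM => //.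
    exact: measurable_tuple_density.
  by rewrite /tuple_density !big_ord0 add0e !mul1r expRK.
have mdf := measurable_tuple_density mf.
have mdg := measurable_tuple_density mg.
have meF : measurable_fun setT (fun t => expR (F t)) by exact: measurableT_comp.
pose f' (i : 'I_n) := f (lift ord0 i); pose g' (i : 'I_n) := g (lift ord0 i).
have mf' i : measurable_fun setT (f' i) by exact: mf.
have mg' i : measurable_fun setT (g' i) by exact: mg.
have f'0 i y : (0 <= f' i y)%R by exact: f0.
have g'0 i y : (0 <= g' i y)%R by exact: g0.
have f'1 i : \int[mu]_y (f' i y)%:E = 1 by exact: f1.
have g'1 i : \int[mu]_y (g' i y)%:E = 1 by exact: g1.
have mdf' := measurable_tuple_density mf'.
have mdg' := measurable_tuple_density mg'.
have df'0 t : (0 <= tuple_density f' t)%R by exact: tuple_density_ge0.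
have dg'0 t : (0 <= tuple_density g' t)%R by exact: tuple_density_ge0.
have Fc0 y (t : n.-tuple Y) : (0 <= F [tuple of y :: t] <= T)%R by [].
have mFc : measurable_fun setT (fun p : Y * n.-tuple Y => F (tcons p)).
  by apply: (measurableT_comp mF); exact: measurable_tcons.
have mFy y : measurable_fun setT (fun t : n.-tuple Y => F [tuple of y :: t]).
  by apply: (measurableT_comp mF); exact: measurable_cons_section.
have meFy y : measurable_fun setT (fun t : n.-tuple Y => expR (F [tuple of y :: t])).
  exact: measurableT_comp.
pose H y := \int[tuple_measure mu n]_t
  (tuple_density g' t * expR (F [tuple of y :: t]))%:E.
have mH : measurable_fun setT H.
  apply: (measurable_fun_fubini_tonelli_F (m2 := tuple_measure mu n)
    (fun p => (tuple_density g' p.2 * expR (F (tcons p)))%:E)).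
    apply/measurable_EFinP/measurable_funM; last exact: measurableT_comp.
    by apply: (measurableT_comp mdg').
  by move=> p; rewrite lee_fin mulr_ge0// expR_ge0.
have H1 y : 1 <= H y.
  rewrite -(integral_tuple_density mg' g'0 g'1); apply: ge0_le_integral => //.
  - by move=> t _; rewrite lee_fin.
  - by apply/measurable_EFinP.
  - by apply/measurable_EFinP/measurable_funM.
  - move=> t _; rewrite lee_fin ler_peMr// -expR0 ler_expR.
    by case/andP: (Fc0 y t).
have HT y : H y <= (expR T)%:E.
  rewrite -[leRHS]mule1 -(integral_tuple_density mg' g'0 g'1).
  rewrite -ge0_integralZl//; last 2 first.
  - by apply/measurable_EFinP.
  - by move=> t _; rewrite lee_fin.
  apply: ge0_le_integral => //.
  - by move=> t _; rewrite lee_fin mulr_ge0// expR_ge0.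
  - by apply/measurable_EFinP/measurable_funM.
  - by apply/measurable_EFinP/measurable_funM.
  - move=> t _; rewrite -EFinM lee_fin mulrC ler_wpM2r// ler_expR.
    by case/andP: (Fc0 y t).
have Hfin y : H y \is a fin_num.
  by rewrite ge0_fin_numE ?(le_trans _ (H1 y))// (le_lt_trans (HT y))// ltry.
have fH1 y : (1 <= fine (H y))%R by rewrite -lee_fin fineK.
pose V y := ln (fine (H y)).
have mV : measurable_fun setT V.
  apply: measurableT_comp; first exact: measurable_ln.
  exact: (measurableT_comp _ mH).
have V0T y : (0 <= V y <= T)%R.
  rewrite ln_ge0//= -[leRHS]expRK ler_ln ?posrE ?expR_gt0//.
    by rewrite -lee_fin fineK.
  exact: lt_le_trans (fH1 y).
have eV y : expR (V y) = fine (H y).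
  by rewrite lnK// posrE (lt_le_trans _ (fH1 y)).
set D := \sum_(i < n.+1) _.
pose D' := \sum_(i < n) \int[mu]_y phi (f' i y) (g' i y).
have D'0 : 0 <= D'.
  by apply: sume_ge0 => i _; apply: integral_ge0 => y _; exact: phi_ge0.
have DE : D = \int[mu]_y phi (f ord0 y) (g ord0 y) + D' by rewrite /D big_ord_recl.
rewrite integral_tupleS; last 2 first.
- by apply/measurable_EFinP/measurable_funM.
- move=> t; rewrite lee_fin mulr_ge0 ?tuple_density_ge0//.
  by case/andP: (F0 t).
have -> : \int[tuple_measure mu n.+1]_t (tuple_density g t * expR (F t))%:E =
    \int[mu]_y (g ord0 y * expR (V y))%:E.
  rewrite integral_tupleS; last 2 first.
  - by apply/measurable_EFinP/measurable_funM.
  - by move=> t; rewrite lee_fin mulr_ge0 ?tuple_density_ge0// expR_ge0.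
  apply: eq_integral => y _; rewrite eV EFinM fineK// -ge0_integralZl//.
  - by apply: eq_integral => t _; rewrite tuple_density_cons -EFinM mulrA.
  - by apply/measurable_EFinP/measurable_funM.
  - by move=> t _; rewrite lee_fin mulr_ge0// expR_ge0.
  - by rewrite lee_fin.
rewrite DE [X in X + _]addeC -addeA.
apply: le_trans (leeD2l D' (donsker_varadhan (mf ord0) (mg ord0) mV
  (f0 ord0) (g0 ord0) V0T (f1 ord0) (g1 ord0))).
have mfV : measurable_fun setT (fun y => (f ord0 y * V y)%:E).
  by apply/measurable_EFinP/measurable_funM => //; exact: mf.
have fV0 y : 0 <= (f ord0 y * V y)%:E.
  by rewrite lee_fin mulr_ge0//; case/andP: (V0T y).
(* [f ord0] has mass 1, so the divergence of the remaining letters can be moved under the integral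
   over the first one. *)
have -> : D' = \int[mu]_y (D' * (f ord0 y)%:E).
  rewrite ge0_integralZl ?f1 ?mule1//.
  - by apply/measurable_EFinP; exact: mf.
  - by move=> y _; rewrite lee_fin.
rewrite -ge0_integralD//; last 2 first.
- by move=> y _; rewrite mule_ge0// lee_fin.
- by apply/measurable_funeM/measurable_EFinP; exact: mf.
have mfF : measurable_fun setT (fun p : Y * n.-tuple Y =>
    (tuple_density f (tcons p) * F (tcons p))%:E).
  apply/measurable_EFinP/measurable_funM => //.
  by apply: (measurableT_comp mdf); exact: measurable_tcons.
apply: ge0_le_integral => //.
- move=> y _; apply: integral_ge0 => t _; rewrite lee_fin mulr_ge0 ?tuple_density_ge0//.
  by case/andP: (Fc0 y t).
- apply: (measurable_fun_fubini_tonelli_F (m2 := tuple_measure mu n) _ mfF).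
  move=> p; rewrite lee_fin mulr_ge0 ?tuple_density_ge0//.
  by case/andP: (F0 (tcons p)).
- apply/emeasurable_funD => //.
  by apply/measurable_funeM/measurable_EFinP; exact: mf.
move=> y _.
rewrite (eq_integral (fun t => (f ord0 y)%:E *
    (tuple_density f' t * F [tuple of y :: t])%:E)); last first.
  by move=> t _; rewrite tuple_density_cons -EFinM mulrA.
rewrite ge0_integralZl//; last 3 first.
- by apply/measurable_EFinP/measurable_funM.
- by move=> t _; rewrite lee_fin mulr_ge0//; case/andP: (Fc0 y t).
- by rewrite lee_fin.
rewrite EFinM [D' * _]muleC -ge0_muleDr//; last by rewrite lee_fin; case/andP: (V0T y).
apply: lee_wpmul2l; first by rewrite lee_fin.
exact: IH.
Qed.

End memoryless.

(** * The converse *)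

Section caratheodory.
Context {R : realType} {d : measure_display} {Y : measurableType d}.

Lemma truncn_grid_cvg (x : R) : 0 <= x ->
  (Num.truncn (k.+1%:R * x))%:R / k.+1%:R @[k --> \oo] --> x.
Proof.
move=> x0.
apply: (@squeeze_cvgr _ _ _ _ (fun k => x - k.+1%:R^-1) (fun=> x)).
- near=> k; have k0 : (0 < k.+1%:R :> R) by rewrite ltr0Sn.
  have /andP[h1 h2] := truncn_itv (mulr_ge0 (ltW k0) x0).
  rewrite ler_pdivrMr// ler_pdivlMr// (mulrC x) h1 andbT.
  rewrite mulrBl mulVf ?gt_eqF// mulrC lerBlDr natr1; exact: ltW.
- by rewrite -[X in _ --> X]subr0; apply: cvgB; [exact: cvg_cst|exact: cvg_harmonic].
- exact: cvg_cst.
Unshelve. all: by end_near. Qed.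

Lemma within_continuous_seq (f : R -> R) (u : nat -> R) (l : R) :
  {within `[0, 1], continuous f} -> (forall k, 0 <= u k <= 1) -> 0 <= l <= 1 ->
  u k @[k --> \oo] --> l -> f (u k) @[k --> \oo] --> f l.
Proof.
move=> /subspace_continuousP cf u01 l01 ul.
have := cf l; rewrite /= in_itv/= => /(_ l01) fl.
apply: cvg_trans fl => A [e e0 eA] /=.
have := ul _ (nbhsx_ballx l e e0); rewrite /nbhs/=.
apply: filterS => k uke; apply: eA => //=.
by rewrite in_itv/=; exact: u01.
Qed.

(** A Caratheodory function is the pointwise limit of its values at the grid points [m / k.+1]. This
    is needed because the query size varies with the private randomness. *)
Lemma measurable_caratheodory d' (Z : measurableType d') (w : R -> Y -> R)
    (u : Z -> R) :
  (forall q, 0 <= q <= 1 -> measurable_fun setT (w q)) ->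
  (forall y, {within `[0, 1], continuous (fun q => w q y)}) ->
  measurable_fun setT u -> (forall z, 0 <= u z <= 1) ->
  measurable_fun setT (fun p : Z * Y => w (u p.1) p.2).
Proof.
move=> mw cw mu u01.
have u0 z : 0 <= u z by case/andP: (u01 z).
(* There are [k.+2] blocks because [u z = 1] falls in the block [m = k.+1]. *)
pose h k (p : Z * Y) : R := \sum_(m < k.+2)
  \1_([set z | m%:R <= k.+1%:R * u z < m.+1%:R]) p.1 * w (m%:R / k.+1%:R) p.2.
have hE k p : h k p = w ((Num.truncn (k.+1%:R * u p.1))%:R / k.+1%:R) p.2.
  have ku0 : 0 <= k.+1%:R * u p.1 by rewrite mulr_ge0.
  have tk : (Num.truncn (k.+1%:R * u p.1)%R < k.+2)%N.
    rewrite truncn_lt_nat// (@le_lt_trans _ _ (k.+1%:R))// ?ltr_nat//.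
    by rewrite ler_piMr//; case/andP: (u01 p.1).
  rewrite /h (bigD1 (Ordinal tk))//= big1 => [|m mk].
    rewrite addr0 indicE mem_set ?mul1r//=.
    exact: truncn_itv.
  rewrite indicE memNset ?mul0r//= => /truncn_def mE.
  by move/eqP : mk; apply; exact/val_inj.
apply: (@measurable_fun_cvg _ _ _ _ h).
- move=> k; apply: measurable_sum => m; apply: measurable_funM.
    set A := [set z | _].
    have mA : measurable A.
      have mku : measurable_fun setT (fun z => k.+1%:R * u z).
        exact: measurable_funM.
      rewrite -[X in measurable X]setTI [X in _ `&` X](_ : _ =
          (fun z => k.+1%:R * u z) @^-1` `[m%:R, m.+1%:R[).
        by apply: mku => //; exact: measurable_itv.
      by apply/seteqP; split => z /=; rewrite in_itv.
    exact: (measurableT_comp (measurable_indic mA) measurable_fst).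
  apply: (measurableT_comp (mw _ _) measurable_snd).
  rewrite divr_ge0//= ler_pdivrMr// mul1r ler_nat.
  by rewrite -ltnS; exact: ltn_ord.
- move=> p _; under eq_fun do rewrite hE.
  apply: (within_continuous_seq (cw p.2)) => //; last exact: truncn_grid_cvg.
  move=> k; rewrite divr_ge0//= ler_pdivrMr// mul1r.
  rewrite (@le_trans _ _ (k.+1%:R * u p.1))//.
    by rewrite truncn_le mulr_ge0.
  by rewrite ler_piMr//; case/andP: (u01 p.1).
Qed.

End caratheodory.

(** * Mutual information as an integral of nonnegative terms *)

Section information.
Context {R : realType} {d : measure_display} {Y : measurableType d}.
Variable mu : {sigma_finite_measure set Y -> \bar R}.

Lemma ln2_gt0 : (0 : R) < ln 2.
Proof. by rewrite ln_gt0// ltr1n. Qed.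

(** Signed divergence integrand in nats, for the case where the second density dominates a positive
    multiple of the first and the value [+oo] cannot occur. *)
Definition klr (a b : R) : R := a * (ln a - ln b).

Lemma measurable_klr d' (Z : measurableType d') (f g : Z -> R) :
  measurable_fun setT f -> measurable_fun setT g ->
  measurable_fun setT (fun y => klr (f y) (g y)).
Proof.
move=> mf mg; apply: measurable_funM => //.
by apply: measurable_funB; apply: measurableT_comp => //; exact: measurable_ln.
Qed.

Lemma phi_klr (c a b : R) : 0 < c -> 0 <= a -> c * a <= b ->
  phi a b = (klr a b - a + b)%:E.
Proof.
move=> c0 a0 ab; rewrite /phi /klr.
have [->|an0] := eqVneq a 0; first by rewrite mul0r subr0 add0r.
have [b0|//] := eqVneq b 0.
have : 0 < c * a by rewrite mulr_gt0// lt_neqAle eq_sym an0.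
by rewrite ltNge -b0 ab.
Qed.

Lemma kl_term_klr (c a b : R) : 0 <= c -> 0 <= a -> c * a <= b ->
  kl_term (c * a) (c * b) = ((ln 2)^-1 * c * klr a b)%:E.
Proof.
move=> c0 a0 ab; rewrite /kl_term /klr /log2 mulf_eq0.
have [->|cn0]/= := eqVneq c 0; first by rewrite mulr0 !mul0r.
have [->|an0] := eqVneq a 0; first by rewrite !mul0r mulr0.
have {cn0}c0 : 0 < c by rewrite lt_neqAle eq_sym cn0.
have {an0}a0 : 0 < a by rewrite lt_neqAle eq_sym an0.
have b0 : 0 < b by rewrite (lt_le_trans _ ab)// mulr_gt0.
rewrite ifF; last by rewrite mulf_eq0 !gt_eqF.
rewrite -mulf_div divff ?gt_eqF// mul1r ln_div ?posrE//; congr EFin.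
by field; rewrite gt_eqF// ln2_gt0.
Qed.

Section densities.
Variables (c : R) (f g : Y -> R).
Hypotheses (c0 : 0 < c) (mf : measurable_fun setT f) (mg : measurable_fun setT g).
Hypotheses (f0 : forall y, 0 <= f y) (fg : forall y, c * f y <= g y).
Hypotheses (f1 : (\int[mu]_y (f y)%:E = 1)%E) (g1 : (\int[mu]_y (g y)%:E = 1)%E).

Let g0 y : 0 <= g y.
Proof. by rewrite (le_trans _ (fg y))// mulr_ge0// ltW. Qed.

Let intf : mu.-integrable setT (EFin \o f).
Proof.
apply/integrableP; split; first exact/measurable_EFinP.
under eq_integral do rewrite /= ger0_norm//.
by rewrite f1 ltry.
Qed.

Let intg : mu.-integrable setT (EFin \o g).
Proof.
apply/integrableP; split; first exact/measurable_EFinP.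
under eq_integral do rewrite /= ger0_norm//.
by rewrite g1 ltry.
Qed.

(** From below, [phi >= 0] gives [klr >= f - g]; from above, [g >= c f] gives
    [ln f - ln g <= - ln c]. The majorant is integrable, so the signed integral can be split. *)
Lemma klr_bound y : `|klr (f y) (g y)| <= `|ln c| * f y + g y + f y.
Proof.
have [f0y|fn0] := eqVneq (f y) 0.
  by rewrite /klr f0y !mul0r normr0 mulr0 add0r addr0.
have fy : 0 < f y by rewrite lt_neqAle eq_sym fn0/=.
have gy : 0 < g y by rewrite (lt_le_trans _ (fg y))// mulr_gt0.
rewrite ler_norml; apply/andP; split.
  have := phi_ge0 (f0 y) (g0 y); rewrite (phi_klr c0)// lee_fin.
  have : 0 <= `|ln c| * f y by rewrite mulr_ge0.
  have := f0 y; lra.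
apply: (@le_trans _ _ (`|ln c| * f y)); last by have := f0 y; have := g0 y; lra.
rewrite /klr mulrC ler_wpM2r//.
have : ln (c * f y) <= ln (g y) by rewrite ler_ln ?posrE// mulr_gt0.
rewrite lnM ?posrE// => h.
have : - ln c <= `|ln c| by rewrite -normrN ler_norm.
lra.
Qed.

Lemma integrable_klr : mu.-integrable setT (fun y => (klr (f y) (g y))%:E).
Proof.
apply: (@le_integrable _ _ _ mu _ _ _
  (fun y => (`|ln c| * f y + g y + f y)%:E)) => //.
- by apply/measurable_EFinP/measurable_klr.
- move=> y _; rewrite /= lee_fin [leRHS]ger0_norm ?klr_bound//.
  exact: le_trans (klr_bound y).
- under eq_fun do rewrite !EFinD.
  apply: integrableD => //; apply: integrableD => //.
  under eq_fun do rewrite EFinM.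
  exact: integrableZl.
Qed.

Lemma integral_klr :
  (\int[mu]_y (klr (f y) (g y))%:E = \int[mu]_y phi (f y) (g y))%E.
Proof.
have E y : phi (f y) (g y) = ((klr (f y) (g y))%:E + ((g y)%:E - (f y)%:E))%E.
  by rewrite (phi_klr c0)// -!EFinB -EFinD; congr EFin; ring.
under [RHS]eq_integral do rewrite E.
rewrite integralD//; last 2 first.
- exact: integrable_klr.
- exact: integrableB.
by rewrite integralB// f1 g1 subee// adde0.
Qed.

End densities.

Variable W : R -> bool -> Y -> R.
Hypothesis WC : is_channel mu W.

Lemma channel_measurable q x : 0 <= q <= 1 -> measurable_fun setT (W q x).
Proof. by move=> q01; have [] := WC x q01. Qed.

Lemma channel_ge0 q x y : 0 <= q <= 1 -> 0 <= W q x y.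
Proof. by move=> q01; have [] := WC x q01. Qed.

Lemma channel_integral q x : 0 <= q <= 1 -> (\int[mu]_y (W q x y)%:E = 1)%E.
Proof. by move=> q01; have [] := WC x q01. Qed.

Lemma output_densityE p q y :
  output_density W p q y = p * W q true y + (1 - p) * W q false y.
Proof. by rewrite /output_density big_bool. Qed.

Lemma input_pmf_ge0 (p : R) x : 0 <= p <= 1 -> 0 <= input_pmf p x.
Proof. by case/andP => p0 p1; case: x => //=; rewrite subr_ge0. Qed.

Section fixed.
Variables (p q : R).
Hypotheses (p01 : 0 <= p <= 1) (q01 : 0 <= q <= 1).

Let p0 : 0 <= p. Proof. by case/andP: p01. Qed.
Let p1 : 0 <= 1 - p. Proof. by rewrite subr_ge0; case/andP: p01. Qed.

Lemma output_density_ge0 y : 0 <= output_density W p q y.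
Proof. by rewrite output_densityE addr_ge0// mulr_ge0//; exact: channel_ge0. Qed.

Lemma measurable_output_density : measurable_fun setT (output_density W p q).
Proof.
rewrite (_ : output_density W p q =
    (fun y => p * W q true y + (1 - p) * W q false y)).
  by apply: measurable_funD; apply: measurable_funM => //; exact: channel_measurable.
by apply/funext => y; rewrite output_densityE.
Qed.

Lemma integral_output_density : (\int[mu]_y (output_density W p q y)%:E = 1)%E.
Proof.
under eq_integral do rewrite output_densityE EFinD !EFinM.
have mW x : measurable_fun setT (fun y => (W q x y)%:E).
  by apply/measurable_EFinP; exact: channel_measurable.
have W0 x y : (0 <= (W q x y)%:E)%E by rewrite lee_fin channel_ge0.
rewrite ge0_integralD//; last 4 first.
- by move=> y _; rewrite mule_ge0// lee_fin.
- exact: measurable_funeM.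
- by move=> y _; rewrite mule_ge0// lee_fin.
- exact: measurable_funeM.
rewrite !ge0_integralZl// !channel_integral// !mule1 -EFinD.
by congr EFin; ring.
Qed.

Lemma input_le_output x y : input_pmf p x * W q x y <= output_density W p q y.
Proof.
rewrite output_densityE; case: x => /=.
  by rewrite lerDl mulr_ge0// channel_ge0.
by rewrite lerDr mulr_ge0// channel_ge0.
Qed.

Lemma kl_input x :
  (\int[mu]_y kl_term (input_pmf p x * W q x y)%R
     (input_pmf p x * output_density W p q y)%R =
   ((ln 2)^-1 * input_pmf p x)%R%:E *
   \int[mu]_y phi (W q x y) (output_density W p q y))%E.
Proof.
have px0 := input_pmf_ge0 x p01.
have mW := channel_measurable x q01.
have W0 y : 0 <= W q x y by exact: channel_ge0.
have W1 := channel_integral x q01.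
have mo := measurable_output_density.
have o1 := integral_output_density.
have lx := input_le_output x.
have o0 := output_density_ge0.
under eq_integral do rewrite kl_term_klr// EFinM.
(* The domination constant is the input probability itself, so a letter of probability 0 is treated
   apart: there both sides vanish, whatever the divergence. *)
have [->|pn0] := eqVneq (input_pmf p x) 0.
  by rewrite mulr0 mul0e; under eq_integral do rewrite mul0e; rewrite integral0.
have {px0 pn0}px0 : 0 < input_pmf p x by rewrite lt_neqAle eq_sym pn0.
rewrite integralZl//; last exact: (@integrable_klr (input_pmf p x)).
by rewrite (@integral_klr (input_pmf p x)).
Qed.

Lemma mutual_info_phi :
  ((ln 2)%:E * mutual_info mu W p q =
  p%:E * \int[mu]_y phi (W q true y) (output_density W p q y) +
  (1 - p)%:E * \int[mu]_y phi (W q false y) (output_density W p q y))%E.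
Proof.
rewrite /mutual_info big_bool !kl_input/=.
have phii0 x : (0 <= \int[mu]_y phi (W q x y) (output_density W p q y))%E.
  apply: integral_ge0 => y _; apply: phi_ge0; first exact: channel_ge0.
  exact: output_density_ge0.
have l2 := ln2_gt0.
rewrite ge0_muleDr ?mule_ge0 ?lee_fin ?mulr_ge0 ?invr_ge0//; try exact: ltW.
by rewrite !muleA -!EFinM !mulrA divff ?gt_eqF// !mul1r.
Qed.

Lemma mutual_info_ge0 : (0 <= mutual_info mu W p q)%E.
Proof.
have : (0 <= (ln 2)%:E * mutual_info mu W p q)%E.
  rewrite mutual_info_phi adde_ge0// mule_ge0 ?lee_fin//;
    apply: integral_ge0 => y _; apply: phi_ge0; rewrite ?channel_ge0//;
    exact: output_density_ge0.
by rewrite pmule_rge0// lte_fin ln2_gt0.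
Qed.

(* The pointwise Jensen gap of [x ln x]. *)
Definition info_gap (p a1 a0 : R) : R :=
  p * klr a1 (p * a1 + (1 - p) * a0) + (1 - p) * klr a0 (p * a1 + (1 - p) * a0).

(** The weighted divergences merge into one finite nonnegative integrand. It is the limit integrand
    in both uses of Fatou's lemma: semicontinuity in [q], and the slope at [rho = 0]. *)
Lemma mutual_info_gap :
  ((ln 2)%:E * mutual_info mu W p q =
   \int[mu]_y (info_gap p (W q true y) (W q false y))%:E)%E.
Proof.
have phii0 x y : (0 <= phi (W q x y) (output_density W p q y))%E.
  by apply: phi_ge0; [exact: channel_ge0|exact: output_density_ge0].
have mphi x : measurable_fun setT
    (fun y => phi (W q x y) (output_density W p q y)).
  apply: measurable_phi; first exact: channel_measurable.
  exact: measurable_output_density.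
rewrite mutual_info_phi -!ge0_integralZl//.
rewrite -ge0_integralD//; last 4 first.
- by move=> y _; rewrite mule_ge0.
- exact: measurable_funeM.
- by move=> y _; rewrite mule_ge0.
- exact: measurable_funeM.
apply: eq_integral => y _.
have E x : ((input_pmf p x)%:E * phi (W q x y) (output_density W p q y) =
    (input_pmf p x * (klr (W q x y) (output_density W p q y) - W q x y +
      output_density W p q y))%:E)%E.
  have [->|pn0] := eqVneq (input_pmf p x) 0; first by rewrite mul0e mul0r.
  rewrite (@phi_klr (input_pmf p x))//.
  - by rewrite lt_neqAle eq_sym pn0 input_pmf_ge0.
  - exact: channel_ge0.
  - exact: input_le_output.
rewrite (E true) (E false) -EFinD; congr EFin.
by rewrite /info_gap output_densityE /=; ring.
Qed.

Lemma info_gap_ge0 a1 a0 : 0 <= a1 -> 0 <= a0 -> 0 <= info_gap p a1 a0.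
Proof.
move=> a10 a00; set b := p * a1 + (1 - p) * a0.
have b0 : 0 <= b by rewrite addr_ge0// mulr_ge0.
(* Each letter satisfies [klr a b >= a - b] with its weight, and these linear terms cancel because
   [b] is the mean. *)
suff H : forall c a, 0 <= c -> 0 <= a -> c * a <= b ->
    c * a - c * b <= c * klr a b.
  have h1 : p * a1 - p * b <= p * klr a1 b.
    by apply: H => //; rewrite lerDl mulr_ge0.
  have h0 : (1 - p) * a0 - (1 - p) * b <= (1 - p) * klr a0 b.
    by apply: H => //; rewrite lerDr mulr_ge0.
  rewrite /info_gap -/b; have -> : 0 = p * a1 - p * b + ((1 - p) * a0 - (1 - p) * b).
    by rewrite /b; ring.
  exact: lerD.
move=> c a c0 ap cab; have [->|cn0] := eqVneq c 0; first by rewrite !mul0r subr0.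
rewrite -mulrBr ler_wpM2l//.
have cp : 0 < c by rewrite lt_neqAle eq_sym cn0.
by have := phi_ge0 ap b0; rewrite (phi_klr cp)// lee_fin; lra.
Qed.

End fixed.

End information.

(** * Fatou's lemma and lower semicontinuity of the information *)

Section limits.
Context {R : realType}.

Lemma limn_einf_le (u : nat -> \bar R) (M : \bar R) :
  (forall k, u k <= M)%E -> (limn_einf u <= M)%E.
Proof.
move=> uM; rewrite limn_einf_lim; apply: lime_le; first exact: is_cvg_einfs.
apply: nearW => k; apply: le_trans (uM k).
by apply: ereal_inf_lbound; exists k => /=.
Qed.

Lemma fatou_le d (Y : measurableType d) (mu : {measure set Y -> \bar R})
    (g : nat -> Y -> R) (h : Y -> R) (M : \bar R) :
  (forall k, measurable_fun setT (g k)) -> (forall k y, 0 <= g k y) ->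
  (forall y, g k y @[k --> \oo] --> h y) ->
  (forall k, \int[mu]_y (g k y)%:E <= M)%E -> (\int[mu]_y (h y)%:E <= M)%E.
Proof.
move=> mg g0 gh gM.
have := @fatou _ _ _ mu _ measurableT (fun k y => (g k y)%:E).
move=> /(_ (fun k => (measurable_EFinP _ _).2 (mg k)) (fun k y _ => g0 k y)) F.
apply: le_trans (limn_einf_le gM); apply: le_trans F.
rewrite le_eqVlt; apply/orP; left; apply/eqP; apply: eq_integral => y _.
have gE : (g k y)%:E @[k --> \oo] --> (h y)%:E.
  by apply: cvg_EFin; [exact: nearW|exact: gh].
by have [-> _] := cvg_limn_einf_sup gE.
Qed.

(** From [ln (1 / s) <= 1 / s - 1] with [s = Num.sqrt x]. It gives continuity of [x ln x] at 0 and,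
    for the random code, an explicit threshold under which [delta ln (1 / delta)] is small. *)
Lemma xlnx_bound (x : R) : 0 <= x <= 1 -> `|x * ln x| <= 2 * Num.sqrt x.
Proof.
case/andP; rewrite le_eqVlt => /predU1P[<-|x0] x1.
  by rewrite mul0r normr0 sqrtr0 mulr0.
set s := Num.sqrt x; have s0 : 0 < s by rewrite sqrtr_gt0.
have xs : x = s * s by rewrite -expr2 sqr_sqrtr// ltW.
have := expR_ge1Dx (ln s^-1); rewrite lnK ?posrE ?invr_gt0// => h.
have {h} : s * (1 + ln s^-1) <= 1.
  by rewrite mulrC -ler_pdivlMr// mul1r.
rewrite lnV ?posrE// => h.
rewrite ler0_norm; last by rewrite mulr_ge0_le0 ?(ltW x0)// ln_le0.
rewrite {2}xs lnM ?posrE// {1}xs; nra.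
Qed.

Lemma xlnx_cvg (u : nat -> R) (l : R) : (forall k, 0 <= u k) ->
  u k @[k --> \oo] --> l -> u k * ln (u k) @[k --> \oo] --> l * ln l.
Proof.
move=> u0 ul.
have : 0 <= l.
  rewrite -(cvg_lim (@Rhausdorff R) ul); apply: limr_ge; last exact: nearW.
  by apply/cvg_ex; exists l.
rewrite le_eqVlt => /predU1P[l0|l0]; last first.
  by apply: cvgM => //; apply: continuous_cvg => //; exact: continuous_ln.
rewrite -l0 mul0r; apply/norm_cvg0P.
apply: (@squeeze_cvgr _ _ _ _ (fun=> 0) (fun k => 2 * Num.sqrt (u k))).
- near=> k; rewrite normr_ge0/=; apply: xlnx_bound; rewrite u0/=.
  by near: k; apply: (cvgr_le l) => //; rewrite -l0.
- exact: cvg_cst.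
- rewrite -[X in _ --> X](mulr0 2); apply: cvgM; first exact: cvg_cst.
  rewrite -[X in _ --> X]sqrtr0 l0; apply: continuous_cvg => //.
  exact: sqrt_continuous.
Unshelve. all: by end_near. Qed.

End limits.

Section semicontinuity.
Context {R : realType} {d : measure_display} {Y : measurableType d}.
Variable mu : {sigma_finite_measure set Y -> \bar R}.
Variable W : R -> bool -> Y -> R.
Hypothesis WC : is_channel mu W.
Hypothesis W_cont : forall x y, {within `[0, 1], continuous (fun q => W q x y)}.

Lemma info_gapE (p a1 a0 : R) : info_gap p a1 a0 =
  p * (a1 * ln a1) + (1 - p) * (a0 * ln a0) -
  (p * a1 + (1 - p) * a0) * ln (p * a1 + (1 - p) * a0).
Proof. by rewrite /info_gap /klr; ring. Qed.

Lemma measurable_info_gap p (f g : Y -> R) :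
  measurable_fun setT f -> measurable_fun setT g ->
  measurable_fun setT (fun y => info_gap p (f y) (g y)).
Proof.
move=> mf mg.
have mo : measurable_fun setT (fun y => p * f y + (1 - p) * g y).
  by apply: measurable_funD; exact: measurable_funM.
by apply: measurable_funD; apply: measurable_funM => //; exact: measurable_klr.
Qed.

(** Lower semicontinuity is the half of continuity that carries an upper bound over to limit sizes;
    prior and channel move together with [q]. *)
Lemma mutual_info_lsc (q : nat -> R) (l : R) (M : \bar R) :
  (forall k, 0 <= q k <= 1) -> 0 <= l <= 1 -> q k @[k --> \oo] --> l ->
  (forall k, mutual_info mu W (q k) (q k) <= M)%E ->
  (mutual_info mu W l l <= M)%E.
Proof.
move=> q01 l01 ql qM.
have l2 := @ln2_gt0 R.
rewrite -(@lee_pmul2l _ (ln 2)%:E)// mutual_info_gap//.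
apply: (@fatou_le _ _ _ _
  (fun k y => info_gap (q k) (W (q k) true y) (W (q k) false y))).
- by move=> k; apply: measurable_info_gap; exact: (channel_measurable WC).
- by move=> k y; apply: info_gap_ge0 => //; exact: (channel_ge0 WC).
(* Written with values of [x ln x], the gap converges pointwise even where densities vanish. *)
- move=> y; under eq_fun do rewrite info_gapE.
  rewrite info_gapE.
  have cW x : W (q k) x y @[k --> \oo] --> W l x y.
    exact: (@within_continuous_seq _ (fun q => W q x y)).
  have cWl x : W (q k) x y * ln (W (q k) x y) @[k --> \oo] -->
      W l x y * ln (W l x y).
    by apply: xlnx_cvg => // k; exact: (channel_ge0 WC).
  have cq : 1 - q k @[k --> \oo] --> 1 - l by apply: cvgB => //; exact: cvg_cst.
  apply: cvgB.
    by apply: cvgD; apply: cvgM.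
  apply: (@xlnx_cvg _ (fun k => q k * W (q k) true y + (1 - q k) * W (q k) false y)).
    move=> k; have /andP[? ?] := q01 k.
    by rewrite addr_ge0// mulr_ge0 ?subr_ge0// (channel_ge0 WC).
  by apply: cvgD; apply: cvgM.
- by move=> k; rewrite -mutual_info_gap// lee_pmul2l.
Qed.

End semicontinuity.

(** * One-shot converse for a fixed strategy *)

Section converse.
Context {R : realType} {d : measure_display} {Y : measurableType d}.
Variable mu : {sigma_finite_measure set Y -> \bar R}.
Variable W : R -> bool -> Y -> R.
Hypothesis WC : is_channel mu W.
Hypothesis W_cont : forall x y, {within `[0, 1], continuous (fun q => W q x y)}.

Variable s : nonadaptive_strategy R Y.
Let n := nqueries s.
Let Z := (rand s * measurableTypeR R)%type.
Local Notation leb := (@lebesgue_measure R).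

Let S (i : 'I_n) := [set uw : Z | query i uw.1 uw.2].

Let mS i : measurable (S i).
Proof. exact: query_measurable. Qed.

Lemma query_xsection (i : 'I_n) (u : rand s) : query i u = xsection (S i) u.
Proof. by rewrite /xsection; apply/seteqP; split => w /=; rewrite inE. Qed.

Lemma measurable_query (i : 'I_n) (u : rand s) : measurable (query i u : set (measurableTypeR R)).
Proof. by rewrite query_xsection; exact: measurable_xsection. Qed.

Lemma lebesgue_measure_unit : leb `[0, 1[%classic = 1%E.
Proof. by rewrite lebesgue_measure_itv/= lte01 oppr0 adde0. Qed.

Lemma query_lebesgue_le1 (i : 'I_n) (u : rand s) : (leb (query i u) <= 1)%E.
Proof.
rewrite -lebesgue_measure_unit; apply: le_measure; rewrite ?inE.
- exact: measurable_query.
- exact: measurable_itv.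
- exact: query_sub.
Qed.

Lemma query_lebesgue_fin (i : 'I_n) (u : rand s) : leb (query i u) \is a fin_num.
Proof.
by rewrite ge0_fin_numE// (le_lt_trans (query_lebesgue_le1 i u))// ltry.
Qed.

Lemma query_size01 (i : 'I_n) (u : rand s) : 0 <= query_size i u <= 1.
Proof.
rewrite /query_size fine_ge0//= -lee_fin fineK ?query_lebesgue_fin//.
exact: query_lebesgue_le1.
Qed.

Lemma measurable_query_size (i : 'I_n) :
  measurable_fun setT (fun u : rand s => query_size i u).
Proof.
apply: (measurableT_comp (f := fine)) => //.
rewrite (_ : (fun u : rand s => lebesgue_measure (query i u)) = leb \o xsection (S i)).
  exact: measurable_fun_xsection.
by apply/funext => u /=; rewrite -query_xsection.
Qed.

(** [z] pairs the private randomness with the target. [f] is the true law of answer [i]; [g] is its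
    reference law, which depends on the size of the query but not on the target. *)
Let f (z : Z) (i : 'I_n) : Y -> R := W (query_size i z.1) (z.2 \in query i z.1).
Let g (u : rand s) (i : 'I_n) : Y -> R :=
  output_density W (query_size i u) (query_size i u).
Variable delta : R.
Hypothesis delta0 : 0 < delta.
Let A (z : Z) : set (n.-tuple Y) := [set t | `|estimator z.1 t - z.2| <= delta].

Let mW (i : 'I_n) x : measurable_fun setT
  (fun p : rand s * Y => W (query_size i p.1) x p.2).
Proof.
apply: (measurable_caratheodory (w := fun q => W q x)) => //.
- by move=> q q01; exact: (channel_measurable WC).
- exact: measurable_query_size.
- exact: query_size01.
Qed.

Let mhit d' (X : measurableType d') (h : X -> Z) (i : 'I_n) : measurable_fun setT h ->
  measurable_fun setT (fun x => (h x).2 \in query i (h x).1).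
Proof.
move=> mh; apply: (measurable_fun_bool true).
rewrite (_ : _ @^-1` _ = h @^-1` S i).
  exact: (mh measurableT _ (mS i)).
apply/seteqP; split => x /=; [by move/set_mem|by move/mem_set].
Qed.

Let mf : measurable_fun setT (fun p : Z * n.-tuple Y => tuple_density (f p.1) p.2).
Proof.
apply: measurable_prod => i _.
have mt : measurable_fun setT (fun p : Z * n.-tuple Y => (p.1.1, tnth p.2 i)).
  apply/measurable_fun_pair.
    by apply: (measurableT_comp measurable_fst); exact: measurable_fst.
  by apply: (measurableT_comp (measurable_tnth i)); exact: measurable_snd.
rewrite (_ : (fun x => _) = fun p : Z * n.-tuple Y =>
   if p.1.2 \in query i p.1.1 then W (query_size i p.1.1) true (tnth p.2 i)
   else W (query_size i p.1.1) false (tnth p.2 i)); last first.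
  by apply/funext => p; rewrite /f; case: (_ \in _).
apply: measurable_fun_ifT.
- exact: (@mhit _ _ (fun p : Z * n.-tuple Y => p.1) i measurable_fst).
- exact: (measurableT_comp (mW i true) mt).
- exact: (measurableT_comp (mW i false) mt).
Qed.

Let mg : measurable_fun setT (fun p : Z * n.-tuple Y => tuple_density (g p.1.1) p.2).
Proof.
apply: measurable_prod => i _.
have mt : measurable_fun setT (fun p : Z * n.-tuple Y => (p.1.1, tnth p.2 i)).
  apply/measurable_fun_pair.
    by apply: (measurableT_comp measurable_fst); exact: measurable_fst.
  by apply: (measurableT_comp (measurable_tnth i)); exact: measurable_snd.
have mq : measurable_fun setT (fun p : Z * n.-tuple Y => query_size i p.1.1).
  apply: (measurableT_comp (measurable_query_size i)).
  by apply: (measurableT_comp measurable_fst); exact: measurable_fst.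
rewrite (_ : (fun x => _) = fun p : Z * n.-tuple Y =>
   query_size i p.1.1 * W (query_size i p.1.1) true (tnth p.2 i) +
   (1 - query_size i p.1.1) * W (query_size i p.1.1) false (tnth p.2 i)); last first.
  by apply/funext => p; rewrite /g output_densityE.
apply: measurable_funD; apply: measurable_funM.
- exact: mq.
- exact: (measurableT_comp (mW i true) mt).
- exact: measurable_funB.
- exact: (measurableT_comp (mW i false) mt).
Qed.

Let mA : measurable [set p : Z * n.-tuple Y | A p.1 p.2].
Proof.
have me : measurable_fun setT
    (fun p : Z * n.-tuple Y => `|estimator p.1.1 p.2 - p.1.2|).
  apply: measurableT_comp => //; apply: measurable_funB.
    apply: (measurableT_comp (f := fun uy => estimator uy.1 uy.2)
      (g := fun p : Z * n.-tuple Y => (p.1.1, p.2))).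
      exact: estimator_measurable.
    apply/measurable_fun_pair; last exact: measurable_snd.
    by apply: (measurableT_comp measurable_fst); exact: measurable_fst.
  by apply: (measurableT_comp measurable_snd); exact: measurable_fst.
rewrite -[X in measurable X]setTI
  [X in _ `&` X](_ : _ = (fun p => `|estimator p.1.1 p.2 - p.1.2|) @^-1` `]-oo, delta]).
  by apply: me => //; exact: measurable_itv.
by apply/seteqP; split => p /=; rewrite in_itv.
Qed.

Let f0 z i y : 0 <= f z i y.
Proof. exact: (channel_ge0 WC _ _ (query_size01 _ _)). Qed.

Let mfi z i : measurable_fun setT (f z i).
Proof. exact: (channel_measurable WC _ (query_size01 _ _)). Qed.

Let f1 z i : (\int[mu]_y (f z i y)%:E = 1)%E.
Proof. exact: (channel_integral WC _ (query_size01 _ _)). Qed.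

Let g0 u i y : 0 <= g u i y.
Proof. by apply: (output_density_ge0 WC); exact: query_size01. Qed.

Let mgi u i : measurable_fun setT (g u i).
Proof. by apply: (measurable_output_density WC); exact: query_size01. Qed.

Let g1 u i : (\int[mu]_y (g u i y)%:E = 1)%E.
Proof. by apply: (integral_output_density WC); exact: query_size01. Qed.

Let mAz z : measurable (A z).
Proof.
by rewrite [A z](_ : _ = xsection [set p : Z * n.-tuple Y | A p.1 p.2] z);
  [exact: measurable_xsection|rewrite /xsection;
   apply/seteqP; split => t /=; rewrite inE].
Qed.

Let nu := tuple_measure mu n.

Let mAi : measurable_fun setT (fun p : Z * n.-tuple Y => \1_(A p.1) p.2 : R).
Proof.
rewrite (_ : (fun p => _) = \1_[set p : Z * n.-tuple Y | A p.1 p.2]).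
  exact: measurable_indic.
by apply/funext => p; rewrite !indicE; congr (nat_of_bool _)%:R; rewrite !mem_setE.
Qed.

Let G z : \bar R := (\int[nu]_t (tuple_density (f z) t * \1_(A z) t)%:E)%E.
Let H z : \bar R := (\int[nu]_t (tuple_density (g z.1) t * \1_(A z) t)%:E)%E.

Let G0 z : (0 <= G z)%E.
Proof.
by apply: integral_ge0 => t _; rewrite lee_fin mulr_ge0// tuple_density_ge0.
Qed.

Let H0 z : (0 <= H z)%E.
Proof.
by apply: integral_ge0 => t _; rewrite lee_fin mulr_ge0// tuple_density_ge0.
Qed.

Let mG : measurable_fun setT G.
Proof.
apply: (measurable_fun_fubini_tonelli_F (m2 := nu)
  (fun p => (tuple_density (f p.1) p.2 * \1_(A p.1) p.2)%:E)).
  by apply/measurable_EFinP; exact: measurable_funM.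
by move=> p; rewrite lee_fin mulr_ge0// tuple_density_ge0.
Qed.

Let mH : measurable_fun setT H.
Proof.
apply: (measurable_fun_fubini_tonelli_F (m2 := nu)
  (fun p => (tuple_density (g p.1.1) p.2 * \1_(A p.1) p.2)%:E)).
  by apply/measurable_EFinP; exact: measurable_funM.
by move=> p; rewrite lee_fin mulr_ge0// tuple_density_ge0.
Qed.

Let Phi u i x : \bar R :=
  (\int[mu]_y phi (W (query_size i u) x y) (g u i y))%E.

Let Phi0 u i x : (0 <= Phi u i x)%E.
Proof.
apply: integral_ge0 => y _; apply: phi_ge0 => //.
exact: (channel_ge0 WC _ _ (query_size01 _ _)).
Qed.

(** With [T] times the success indicator as test function, the exponential is [1 + (expR T - 1)]
    times the indicator, so the log-partition term is [ln (1 + (expR T - 1) * H z)], bounded by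
    [ln (1 + x) <= x]. *)
Let dv_hit (T : R) z : 0 <= T ->
  (T%:E * G z <= \sum_(i < n) Phi z.1 i (z.2 \in query i z.1) +
                 (expR T - 1)%:E * H z)%E.
Proof.
move=> T0.
have md := measurable_tuple_density (mfi z).
have mdg := measurable_tuple_density (mgi z.1).
have mI : measurable_fun setT (\1_(A z) : _ -> R) by exact: measurable_indic.
have mTI : measurable_fun setT (fun t => T * \1_(A z) t) by exact: measurable_funM.
have TI t : 0 <= T * \1_(A z) t <= T.
  by rewrite indicE; case: (_ \in _); rewrite ?mulr1 ?mulr0 lexx T0.
have := donsker_varadhan_tuple (mfi z) (mgi z.1) mTI (f0 z) (g0 z.1) TI
  (f1 z) (g1 z.1).
have -> : (\int[tuple_measure mu n]_t
    (tuple_density (f z) t * (T * \1_(A z) t))%:E = T%:E * G z)%E.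
  rewrite /G -ge0_integralZl//.
  - by apply: eq_integral => t _; rewrite -EFinM mulrCA.
  - by apply/measurable_EFinP; exact: measurable_funM.
  - by move=> t _; rewrite lee_fin mulr_ge0// tuple_density_ge0.
move=> /le_trans; apply; apply: leeD2l.
have eT1 : 0 <= expR T - 1 by rewrite subr_ge0 -expR0 ler_expR.
have -> : (\int[tuple_measure mu n]_t
    (tuple_density (g z.1) t * expR (T * \1_(A z) t))%:E =
    1 + (expR T - 1)%:E * H z)%E.
  rewrite -(integral_tuple_density (mgi z.1) (g0 z.1) (g1 z.1)).
  have mgI : measurable_fun setT (fun t => (tuple_density (g z.1) t * \1_(A z) t)%:E).
    by apply/measurable_EFinP; exact: measurable_funM.
  have gI0 t : (0 <= (tuple_density (g z.1) t * \1_(A z) t)%:E)%E.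
    by rewrite lee_fin mulr_ge0// tuple_density_ge0.
  rewrite /H -ge0_integralZl// -ge0_integralD//; last 4 first.
  - by move=> t _; rewrite lee_fin tuple_density_ge0.
  - exact/measurable_EFinP.
  - by move=> t _; rewrite mule_ge0.
  - exact: measurable_funeM.
  apply: eq_integral => t _; rewrite -EFinM -EFinD; congr EFin.
  rewrite indicE; case: (_ \in _); rewrite ?mulr1 ?mulr0 ?expR0 ?addr0 ?mulr1//.
  by ring.
have H1 : (H z <= 1)%E.
  rewrite -(integral_tuple_density (mgi z.1) (g0 z.1) (g1 z.1)).
  apply: ge0_le_integral => //.
  - by move=> t _; rewrite lee_fin mulr_ge0// tuple_density_ge0.
  - by apply/measurable_EFinP; exact: measurable_funM.
  - exact/measurable_EFinP.
  - move=> t _; rewrite lee_fin ler_piMr//; exact: tuple_density_ge0.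
have Hf : H z \is a fin_num by rewrite ge0_fin_numE// (le_lt_trans H1)// ltry.
rewrite -(fineK Hf) -EFinM -EFinD/= lee_fin.
by apply: le_ln1Dx; rewrite (lt_le_trans (ltrN10 _))// mulr_ge0// fine_ge0.
Qed.

Let D := `[0, 1[%classic : set (measurableTypeR R).

Let mD : measurable D. Proof. exact: measurable_itv. Qed.

Variable M : R.
Hypothesis IM :
  forall q, 0 <= q <= 1 -> ((ln 2)%:E * mutual_info mu W q q <= M%:E)%E.

Let mind (E : set (measurableTypeR R)) : measurable E ->
  measurable_fun setT (fun w => (\1_E w)%:E : \bar R).
Proof. by move=> mE; apply/measurable_EFinP; exact: measurable_indic. Qed.

Let int_ind (E : set (measurableTypeR R)) : measurable E ->
  (\int[leb]_w (\1_E w)%:E = leb E)%E.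
Proof. by move=> mE; rewrite integral_indic// setIT. Qed.

Let Phi_split u (i : 'I_n) w :
  ((\1_D w)%:E * Phi u i (w \in query i u) =
   Phi u i true * (\1_(query i u) w)%:E +
   Phi u i false * (\1_(D `\` query i u) w)%:E)%E.
Proof.
rewrite !indicE in_setD; case: (boolP (w \in query i u)) => wq.
  rewrite (_ : w \in D); last by apply/mem_set; apply: query_sub; exact: set_mem wq.
  by rewrite mul1e mule1 mule0 adde0.
by rewrite andbT mule0 add0e muleC.
Qed.

(** A uniform target falls into a query with probability equal to its size, which is also the
    channel parameter: hence both arguments of the information agree. *)
Let Phi_integral u (i : 'I_n) :
  (\int[leb]_w ((\1_D w)%:E * Phi u i (w \in query i u)) <= M%:E)%E.
Proof.
have mq := measurable_query i u.
have mDq : measurable (D `\` query i u) by exact: measurableD.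
under eq_integral do rewrite Phi_split.
rewrite ge0_integralD//; last 4 first.
- by move=> w _; rewrite mule_ge0// lee_fin.
- by apply: emeasurable_funM => //; apply: mind.
- by move=> w _; rewrite mule_ge0// lee_fin.
- by apply: emeasurable_funM => //; apply: mind.
rewrite !ge0_integralZl//; [|exact: mind|exact: mind].
rewrite !int_ind//.
have lq : leb (query i u) = (query_size i u)%:E.
  by rewrite /query_size fineK// query_lebesgue_fin.
have -> : leb (D `\` query i u) = (1 - query_size i u)%:E.
  rewrite EFinB -lq -lebesgue_measure_unit measureD//.
    by congr (_ - lebesgue_measure _)%E; apply: setIidr; exact: query_sub.
  by change (leb D < +oo)%E; rewrite /D lebesgue_measure_unit ltry.
rewrite lq muleC [X in (_ + X)%E]muleC.
by rewrite -mutual_info_phi// ?IM//; exact: query_size01.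
Qed.

Let leb_window (e : R) :
  leb [set w | `|e - w| <= delta] = (2 * delta)%:E.
Proof.
rewrite (_ : [set w | _] = `[e - delta, e + delta]%classic).
  rewrite lebesgue_measure_itv/= lte_fin ltrD2l gtrN// -EFinB.
  by congr EFin; ring.
apply/seteqP; split => w /=; rewrite in_itv/= ler_norml => /andP[h1 h2];
  apply/andP; split; lra.
Qed.

(** The reference law does not involve [w], so by Tonelli the target can be integrated first at a
    fixed output, where it ranges over one window. Integrating over the whole line avoids truncating
    windows at the ends of [0, 1). *)
Let H_integral u : (\int[leb]_w H (u, w) = (2 * delta)%:E)%E.
Proof.
pose h (p : measurableTypeR R * n.-tuple Y) : \bar R :=
  (tuple_density (g u) p.2 * \1_(A (u, p.1)) p.2)%:E.
have mh : measurable_fun setT h.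
  have mup : measurable_fun setT (fun p : measurableTypeR R * n.-tuple Y =>
      ((u, p.1), p.2) : Z * n.-tuple Y).
    apply/measurable_fun_pair; last exact: measurable_snd.
    by apply/measurable_fun_pair; [exact: measurable_cst|exact: measurable_fst].
  apply/measurable_EFinP/measurable_funM.
    exact: (measurableT_comp mg mup).
  exact: (measurableT_comp mAi mup).
have h0 p : (0 <= h p)%E by rewrite lee_fin mulr_ge0// tuple_density_ge0.
rewrite [LHS](fubini_tonelli (m1 := leb) (m2 := nu) h mh h0).
rewrite /fubini_G /h/=.
transitivity (\int[nu]_t ((2 * delta)%:E * (tuple_density (g u) t)%:E))%E.
  apply: eq_integral => t _.
  under eq_integral do rewrite EFinM.
  have mwin : measurable ([set w | `|estimator u t - w| <= delta] : set (measurableTypeR R)).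
    rewrite (_ : [set w | _] =
      `[estimator u t - delta, estimator u t + delta]%classic).
      exact: measurable_itv.
    apply/seteqP; split => w /=; rewrite in_itv/= ler_norml => /andP[h1 h2];
      apply/andP; split; lra.
  have AE (w : measurableTypeR R) : (\1_(A (u, w)) t : R) =
      \1_[set w : measurableTypeR R | `|estimator u t - w| <= delta] w.
    by rewrite !indicE /A !mem_setE.
  under eq_integral do rewrite AE.
  rewrite ge0_integralZl//; last 2 first.
  - exact: mind.
  - by rewrite lee_fin tuple_density_ge0.
  by rewrite int_ind// leb_window muleC.
rewrite ge0_integralZl//; last 3 first.
- by apply/measurable_EFinP; exact: measurable_tuple_density.
- by move=> t _; rewrite lee_fin tuple_density_ge0.
- by rewrite lee_fin mulr_ge0// ltW.
by rewrite integral_tuple_density// mule1.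
Qed.

Let B (z : Z) : \bar R := ((\1_D z.2)%:E * G z)%E.

Let B0 z : (0 <= B z)%E. Proof. by rewrite mule_ge0// lee_fin. Qed.

Let mB : measurable_fun setT B.
Proof.
apply: emeasurable_funM => //.
exact: (measurableT_comp (mind mD) measurable_snd).
Qed.

Let m2u u (h : Z -> \bar R) : measurable_fun setT h ->
  measurable_fun setT (fun w => h (u, w)).
Proof.
move=> mh; apply: (measurableT_comp mh).
by apply/measurable_fun_pair; [exact: measurable_cst|exact: measurable_id].
Qed.

Let B_integral u (T : R) : 0 <= T ->
  (T%:E * \int[leb]_w B (u, w) <=
   (n%:R * M + (expR T - 1) * (2 * delta))%:E)%E.
Proof.
move=> T0.
have eT1 : 0 <= expR T - 1 by rewrite subr_ge0 -expR0 ler_expR.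
have mP i : measurable_fun setT (fun w => Phi u i (w \in query i u)).
  rewrite (_ : (fun w => _) = fun w =>
      if w \in query i u then Phi u i true else Phi u i false); last first.
    by apply/funext => w; case: (_ \in _).
  apply: measurable_fun_ifT => //.
  exact: (@mhit _ _ (fun w => (u, w)) i
    (measurable_fun_pair (measurable_cst u) (@measurable_id _ _ setT))).
have mDP i : measurable_fun setT
    (fun w => ((\1_D w)%:E * Phi u i (w \in query i u))%E).
  exact: (emeasurable_funM (mind mD) (mP i)).
have DP0 i w : (0 <= (\1_D w)%:E * Phi u i (w \in query i u))%E.
  by rewrite mule_ge0// lee_fin.
rewrite -ge0_integralZl//; last exact: m2u.
apply: (@le_trans _ _ (\int[leb]_w
   (\sum_(i < n) ((\1_D w)%:E * Phi u i (w \in query i u)) +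
    (expR T - 1)%:E * H (u, w)))%E).
  apply: ge0_le_integral => //.
  - by move=> w _; rewrite mule_ge0.
  - by apply: measurable_funeM; exact: m2u.
  - apply: emeasurable_funD; first exact: emeasurable_sum.
    by apply: measurable_funeM; exact: m2u.
  - move=> w _; rewrite /B/= indicE; case: (_ \in _).
      rewrite mul1e; under [X in (X + _)%E]eq_bigr do rewrite mul1e.
      exact: (dv_hit (u, w)).
    (* Outside [0, 1) the left side is 0, while the hitting term is kept on the right. *)
    rewrite mul0e mule0; apply: adde_ge0; last by rewrite mule_ge0.
    by apply: sume_ge0 => i _; rewrite mul0e.
rewrite ge0_integralD//; last 4 first.
- by move=> w _; rewrite sume_ge0.
- exact: emeasurable_sum.
- by move=> w _; rewrite mule_ge0.
- by apply: measurable_funeM; exact: m2u.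
rewrite ge0_integral_sum// ge0_integralZl//; last exact: m2u.
rewrite H_integral -EFinM EFinD; apply: leeD2r.
apply: (@le_trans _ _ (\sum_(i < n) M%:E)%E).
  by apply: lee_sum => i _; exact: Phi_integral.
by rewrite sumEFin lee_fin sumr_const card_ord mulr_natl.
Qed.

(** The success guarantee holds for every target, hence on average over a uniform one; after
    exchanging the integrals, [B_integral] bounds the average for each value of the randomness by
    the same number. *)
Lemma converse_bound (eps T : R) : has_resolution mu W s delta eps -> 0 <= T ->
  T * (1 - eps) <= n%:R * M + (expR T - 1) * (2 * delta).
Proof.
move=> res T0.
have eT1 : 0 <= expR T - 1 by rewrite subr_ge0 -expR0 ler_expR.
have succE w : success_prob mu W s delta w = (\int[rand_law s]_u G (u, w))%E.
  apply: eq_integral => u _.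
  exact: (memoryless_probE mu (mfi (u, w)) (f0 (u, w)) (mAz (u, w))).
have int1 : (\int[rand_law s]_u (1 : \bar R) = 1)%E.
  by rewrite integral_cst// mul1e; exact: probability_setT.
have key : (T%:E * \int[rand_law s]_u \int[leb]_w B (u, w) <=
    (n%:R * M + (expR T - 1) * (2 * delta))%:E)%E.
  have mI : measurable_fun setT (fun u => \int[leb]_w B (u, w))%E.
    exact: (measurable_fun_fubini_tonelli_F (m2 := leb) _ mB B0).
  have I0 u : (0 <= \int[leb]_w B (u, w))%E by exact: integral_ge0.
  rewrite -ge0_integralZl//.
  rewrite -[leRHS]mule1 -int1 -ge0_integralZl//; last first.
    by apply: le_trans (B_integral point T0); rewrite mule_ge0.
  apply: ge0_le_integral => //.
  - by move=> u _; rewrite mule_ge0.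
  - exact: measurable_funeM.
  - by move=> u _; rewrite mule1; exact: B_integral.
(* For [eps >= 1] the left side is at most 0; otherwise [1 - eps] is nonnegative, as the comparison
   of integrals demands. *)
have [e1|e1] := leP 1 eps.
  rewrite (@le_trans _ _ 0)//; first by rewrite mulr_ge0_le0// subr_le0.
  rewrite -lee_fin (le_trans _ key)// mule_ge0//.
  by apply: integral_ge0 => u _; exact: integral_ge0.
rewrite -lee_fin (le_trans _ key)// EFinM lee_wpmul2l//.
have -> : (\int[rand_law s]_u \int[leb]_w B (u, w) =
    \int[leb]_w \int[rand_law s]_u B (u, w))%E.
  exact: (fubini_tonelli (m1 := rand_law s) (m2 := leb) B mB B0).
have -> : ((1 - eps)%:E = \int[leb]_w ((1 - eps)%:E * (\1_D w)%:E))%E.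
  rewrite ge0_integralZl//; last 2 first.
  - exact: mind.
  - by rewrite lee_fin subr_ge0 ltW.
  by rewrite int_ind// /D lebesgue_measure_unit mule1.
apply: ge0_le_integral => //.
- by move=> w _; rewrite mule_ge0// lee_fin subr_ge0 ltW.
- by apply: measurable_funeM; exact: mind.
- exact: (measurable_fun_fubini_tonelli_G (m1 := rand_law s) _ mB B0).
move=> w _; rewrite /B/= indicE; case: (boolP (w \in D)) => wD.
  rewrite mule1; under eq_integral do rewrite mul1e.
  rewrite -succE; apply: res; move: (set_mem wD).
  by rewrite /D/= in_itv.
by rewrite mule0 integral_ge0// => u _; rewrite mul0e.
Qed.

End converse.

(** * From the one-shot bound to rates *)

Section converse_rate.
Context {R : realType} {d : measure_display} {Y : measurableType d}.
Variable mu : {sigma_finite_measure set Y -> \bar R}.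
Variable W : R -> bool -> Y -> R.
Hypothesis WC : is_channel mu W.
Hypothesis W_cont : forall x y, {within `[0, 1], continuous (fun q => W q x y)}.

Lemma converse_rate (r J : R) : 0 <= J ->
  (forall q, 0 <= q <= 1 -> (mutual_info mu W q q <= J%:E)%E) ->
  achievable_rate mu W r -> r <= J.
Proof.
move=> J0 IJ [s [delta [eps [sP cdelta ceps]]]]; rewrite leNgt; apply/negP => Jr.
have l2 := @ln2_gt0 R.
have r0 : 0 < r by exact: le_lt_trans Jr.
pose k := J / r.
have k1 : 0 < 1 - k by rewrite subr_gt0 ltr_pdivrMr// mul1r.
have k0 : 0 <= k by rewrite divr_ge0// ltW.
(* Chosen to contradict the end of the proof: with [eps <= (1 - k) / 2] the bound gives
   [T (1 - k) / 2 <= k ln 2 + 1 <= 2], hence [T <= 4 / (1 - k)]. *)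
pose T0 := 4 / (1 - k) + 1 + ln 2.
have T00 : 0 < T0 by rewrite !addr_gt0// divr_gt0.
have [m [dm em]] : exists m, delta m < expR (- T0) / 2 /\ eps m <= (1 - k) / 2.
  have : \forall m \near \oo, delta m < expR (- T0) / 2 /\ eps m <= (1 - k) / 2.
    near=> m; split; near: m.
      by apply: (cvgr_lt 0) => //; rewrite divr_gt0// expR_gt0.
    by apply: (cvgr_le 0) => //; rewrite divr_gt0.
  by case=> m _ /(_ m (leqnn _)) h; exists m.
have [n0 d0 res rate] := sP m.
have d2 : 0 < 2 * delta m by rewrite mulr_gt0.
pose T := - ln (2 * delta m).
have T0T : T0 < T.
  rewrite /T ltrNr -[ltRHS]expRK ltr_ln ?posrE ?expR_gt0//.
  by rewrite mulrC -ltr_pdivlMr.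
have IM q : 0 <= q <= 1 -> ((ln 2)%:E * mutual_info mu W q q <= (ln 2 * J)%:E)%E.
  by move=> /IJ h; rewrite EFinM lee_wpmul2l// lee_fin ltW.
have := converse_bound WC W_cont d0 IM res (ltW (lt_trans T00 T0T)).
have -> : expR T = (2 * delta m)^-1 by rewrite /T expRN lnK// posrE.
have -> : ((2 * delta m)^-1 - 1) * (2 * delta m) = 1 - 2 * delta m.
  by field; rewrite gt_eqF.
set N : R := (nqueries (s m))%:R => cb.
have N0 : 0 < N by rewrite ltr0n.
have lnd : ln (delta m)^-1 = T + ln 2.
  by rewrite lnV ?posrE// /T lnM ?posrE//; ring.
(* The rate condition in nats: as [ln (1 / delta) = T + ln 2], it limits the number of queries from
   above. *)
have nT : N * ln 2 <= (T + ln 2) / r.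
  rewrite ler_pdivlMr// -lnd.
  move: rate; rewrite /log2 -/N ler_pdivlMr// ler_pdivlMr// => h.
  by rewrite mulrAC mulrC mulrA [X in X * _]mulrC mulrAC; lra.
have NM : N * (ln 2 * J) <= k * (T + ln 2).
  have -> : N * (ln 2 * J) = N * ln 2 * J by ring.
  have -> : k * (T + ln 2) = (T + ln 2) / r * J by rewrite /k; ring.
  exact: ler_wpM2r.
have Tp : 0 < T by exact: lt_trans T0T.
have h1 : T * ((1 - k) / 2) <= k * ln 2 + 1.
  have : T * (1 - (1 - k) / 2) <= T * (1 - eps m).
    by rewrite ler_wpM2l// ?(ltW Tp)//; lra.
  nra.
have l21 : ln (2:R) <= 1.
  by rewrite (_ : 2 = 1 + 1 :> R); [apply: le_ln1Dx; lra|ring].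
have h2 : T * ((1 - k) / 2) <= 2.
  apply: (le_trans h1).
  have : k * ln 2 <= 1 * 1 by apply: ler_pM => //; lra.
  lra.
have : T <= 4 / (1 - k) by rewrite ler_pdivlMr//; lra.
by move: T0T; rewrite /T0; lra.
Unshelve. all: by end_near. Qed.

End converse_rate.

(** * Random coding *)

Section permutation_code.
Context {R : realType}.

(** Double transitivity: one transposition moves [a] to [b], and a second one, fixing [b], corrects
    the image of [a']. *)
Lemma perm_moves (T : finType) (a a' b b' : T) : a != a' -> b != b' ->
  exists p : {perm T}, p a = b /\ p a' = b'.
Proof.
move=> aa bb; exists (tperm a b * tperm (tperm a b a') b')%g; split.
  rewrite permM tpermL tpermD// eq_sym//.
  by rewrite -{1}(tpermL a b) (inj_eq perm_inj).
by rewrite permM tpermL.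
Qed.

(** By double transitivity all pairs of distinct points have the same sum, so the images behave like
    two draws without replacement. Adding the diagonal [c = c'] compares them with independent
    draws, at the cost of the ratio of [#|T|] to [#|T|.-1]. *)
Lemma sum_perm_pair (T : finType) (F : T -> T -> R) (a a' : T) : a != a' ->
  (forall c c', 0 <= F c c') ->
  (#|T| * #|T|.-1)%:R * (\sum_(p : {perm T}) F (p a) (p a')) <=
  #|{perm T}|%:R * (\sum_c \sum_c' F c c').
Proof.
move=> aa F0; pose S b b' := \sum_(p : {perm T}) F (p b) (p b').
have SE b b' : b != b' -> S b b' = S a a'.
  move=> bb; have [p [pa pa']] := perm_moves aa bb.
  rewrite /S [RHS](reindex_inj (mulgI p)); apply: eq_bigr => s _.
  by rewrite !permM pa pa'.
have -> : (#|T| * #|T|.-1)%:R * S a a' = \sum_b \sum_(b' | b' != b) S b b'.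
  rewrite natrM -mulrA mulr_natl -sumr_const; apply: eq_bigr => b _.
  rewrite mulr_natl -(cardC1 b) -sumr_const; apply: eq_big => // b' bb.
  by rewrite SE// eq_sym.
under eq_bigr do rewrite exchange_big/=; rewrite exchange_big/=.
rewrite mulr_natl -sumr_const; apply: ler_sum => p _.
rewrite [leRHS](reindex_inj (@perm_inj _ p)); apply: ler_sum => b _.
rewrite [leRHS](reindex_inj (@perm_inj _ p)) big_mkcond.
by apply: ler_sum => b' _; case: ifP.
Qed.

Lemma sum_perm_single (T : finType) (u : T -> R) (a : T) :
  #|T|%:R * (\sum_(p : {perm T}) u (p a)) = #|{perm T}|%:R * (\sum_c u c).
Proof.
pose S b := \sum_(p : {perm T}) u (p b).
have SE b : S b = S a.
  rewrite /S [LHS](reindex_inj (mulgI (tperm a b))); apply: eq_bigr => p _.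
  by rewrite permM tpermR.
transitivity (\sum_b S b).
  by rewrite mulr_natl -sumr_const; apply: eq_bigr => b _; rewrite SE.
rewrite exchange_big/= mulr_natl -sumr_const; apply: eq_bigr => p _.
by rewrite [RHS](reindex_inj (@perm_inj _ p)).
Qed.

Section code.
Variables (N : nat) (k : bool -> nat).
Hypothesis N1 : (1 < N)%N.
Hypothesis kN : forall g, (k g <= N)%N.

(* Cells come in two groups of N; in group g, a uniformly random set of exactly
   [k g] cells is queried. *)
Definition cell := (bool * 'I_N)%type.
Definition column := ('S_N * 'S_N)%type.

Definition group_perm (s : column) (g : bool) : 'S_N := if g then s.1 else s.2.

(** A uniform permutation followed by a threshold yields a uniform subset of prescribed size, and
    keeps all counting inside sums over permutations. *)
Definition bit (s : column) (j : cell) : bool := (group_perm s j.1 j.2 < k j.1)%N.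

Lemma sum_threshold (u : bool -> R) g :
  \sum_(c < N) u (c < k g)%N = (k g)%:R * u true + (N - k g)%:R * u false.
Proof.
have narrow (v : R) : \sum_(c < N | (c < k g)%N) v = (k g)%:R * v.
  by rewrite (big_ord_narrow (kN g)) sumr_const card_ord mulr_natl.
rewrite (bigID (fun c : 'I_N => c < k g)%N)/=; congr (_ + _).
  by rewrite -narrow; apply: eq_bigr => c ->.
rewrite (eq_bigr (fun=> u false)) => [|c /negbTE ->//].
have : \sum_(c < N) u false = N%:R * u false.
  by rewrite sumr_const card_ord mulr_natl.
rewrite (bigID (fun c : 'I_N => c < k g)%N)/= narrow natrB// mulrBl => <-.
by rewrite addrAC subrr add0r.
Qed.

Variables (q K0 : R).
Hypotheses (q01 : 0 <= q <= 1) (K01 : 1 <= K0).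
Hypothesis k1K : forall g, (k g)%:R <= N%:R * (K0 * q).
Hypothesis k0K : forall g, (N - k g)%:R <= N%:R * (K0 * (1 - q)).

Definition avg (u : bool -> R) : R := q * u true + (1 - q) * u false.

(** The proportion of queried cells in a group is not exactly [q]; replacing it by [q] costs the
    factor [K0], for queried and unqueried cells alike. *)
Lemma sum_threshold_le (u : bool -> R) g : (forall x, 0 <= u x) ->
  \sum_(c < N) u (c < k g)%N <= N%:R * (K0 * avg u).
Proof.
move=> u0; rewrite sum_threshold /avg.
have -> : N%:R * (K0 * (q * u true + (1 - q) * u false)) =
  N%:R * (K0 * q) * u true + N%:R * (K0 * (1 - q)) * u false by ring.
by apply: lerD; apply: ler_wpM2r.
Qed.

Let NR : (0 : R) < N%:R. Proof. by rewrite ltr0n ltnW. Qed.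

Lemma sum_group_single (u : bool -> R) g (a : 'I_N) : (forall x, 0 <= u x) ->
  \sum_(p : 'S_N) u (p a < k g)%N <= #|{perm 'I_N}|%:R * (K0 * avg u).
Proof.
move=> u0; rewrite -(ler_pM2l NR) -{1}(card_ord N).
rewrite (sum_perm_single (fun c : 'I_N => u (c < k g)%N)) mulrCA.
by rewrite ler_wpM2l//; exact: sum_threshold_le.
Qed.

Lemma avg_ge0 (u : bool -> R) : (forall x, 0 <= u x) -> 0 <= avg u.
Proof.
by case/andP: q01 => q0 q1 u0; rewrite addr_ge0// mulr_ge0// subr_ge0.
Qed.

(** One factor [K0] for each of the two cells, and [N / (N - 1)] for drawing them without
    replacement. *)
Definition pair_const : R := K0 ^+ 2 * (N%:R / (N.-1)%:R).

Let N1R : (0 : R) < (N.-1)%:R. Proof. by rewrite ltr0n -subn1 subn_gt0. Qed.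

Lemma K0_le_pair_const : K0 ^+ 2 <= pair_const.
Proof.
rewrite /pair_const ler_peMr ?exprn_ge0// ?(le_trans _ K01)//.
by rewrite ler_pdivlMr// mul1r ler_nat leq_pred.
Qed.

Lemma sum_group_pair (u v : bool -> R) g (a a' : 'I_N) : a != a' ->
  (forall x, 0 <= u x) -> (forall x, 0 <= v x) ->
  \sum_(p : 'S_N) u (p a < k g)%N * v (p a' < k g)%N <=
  #|{perm 'I_N}|%:R * (pair_const * (avg u * avg v)).
Proof.
move=> aa u0 v0.
have := sum_perm_pair (F := fun c c' : 'I_N => u (c < k g)%N * v (c' < k g)%N) aa.
move=> /(_ (fun c c' => mulr_ge0 (u0 _) (v0 _))); rewrite card_ord => h.
have NN : (0 : R) < (N * N.-1)%:R by rewrite natrM mulr_gt0.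
rewrite -(ler_pM2l NN) (le_trans h)// mulrCA ler_wpM2l//.
under eq_bigr do rewrite -mulr_sumr; rewrite -mulr_suml.
have -> : (N * N.-1)%:R * (pair_const * (avg u * avg v)) =
  (N%:R * (K0 * avg u)) * (N%:R * (K0 * avg v)).
  by rewrite /pair_const natrM; field; rewrite gt_eqF.
by apply: ler_pM; rewrite ?sumr_ge0//; exact: sum_threshold_le.
Qed.

(** Cells of one group are drawn without replacement; cells of different groups are independent,
    with the smaller constant [K0 ^+ 2]. *)
Lemma sum_col_pair (u v : bool -> R) (j j' : cell) : j != j' ->
  (forall x, 0 <= u x) -> (forall x, 0 <= v x) ->
  \sum_(s : column) u (bit s j) * v (bit s j') <=
  #|{: column}|%:R * (pair_const * (avg u * avg v)).
Proof.
move=> jj u0 v0; rewrite /bit.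
have -> : #|{: column}|%:R = #|{perm 'I_N}|%:R * #|{perm 'I_N}|%:R :> R.
  by rewrite card_prod natrM.
have P0 : (0 : R) <= #|{perm 'I_N}|%:R by [].
have Kuv : K0 * avg u * (K0 * avg v) <= pair_const * (avg u * avg v).
  have -> : K0 * avg u * (K0 * avg v) = K0 ^+ 2 * (avg u * avg v) by ring.
  by rewrite ler_wpM2r ?K0_le_pair_const// mulr_ge0// avg_ge0.
have cross (a a' : 'I_N) (g g' : bool) : g != g' ->
   \sum_(s : column) u (group_perm s g a < k g)%N * v (group_perm s g' a' < k g')%N =
   (\sum_(p : 'S_N) u (p a < k g)%N) * (\sum_(p : 'S_N) v (p a' < k g')%N).
  rewrite -(pair_bigA _ (fun s1 s2 =>
    u (group_perm (s1, s2) g a < k g)%N * v (group_perm (s1, s2) g' a' < k g')%N)).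
  case: g g' => [] [] // _ /=.
    by rewrite mulr_suml; apply: eq_bigr => p _; rewrite mulr_sumr.
  rewrite exchange_big/= mulr_suml; apply: eq_bigr => p _; rewrite mulr_sumr.
  by [].
case: j j' jj => [g a] [g' a'] /=.
have [<-{g'} jj|gg _] := eqVneq g g'; last first.
  rewrite cross//; apply: (@le_trans _ _ (#|{perm 'I_N}|%:R * (K0 * avg u) *
      (#|{perm 'I_N}|%:R * (K0 * avg v)))).
    by apply: ler_pM; rewrite ?sumr_ge0//; exact: sum_group_single.
  by rewrite mulrACA; apply: ler_wpM2l => //; exact: mulr_ge0.
have aa : a != a' by apply: contraNN jj => /eqP ->.
rewrite -(pair_bigA _ (fun s1 s2 =>
    u (group_perm (s1, s2) g a < k g)%N * v (group_perm (s1, s2) g a' < k g)%N)).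
have h := sum_group_pair g aa u0 v0.
case: g {jj cross} h => /= h.
  under eq_bigr do rewrite sumr_const -mulr_natl.
  by rewrite -mulr_sumr -[leRHS]mulrA; apply: ler_wpM2l.
by rewrite sumr_const -[leLHS]mulr_natl -[leRHS]mulrA; apply: ler_wpM2l.
Qed.

(** The pair bound with [v = 1] and a cell of the other group. It gives [pair_const] instead of
    [K0], so that single and pair sums carry the same constant. *)
Lemma sum_col_single (u : bool -> R) (j : cell) : (forall x, 0 <= u x) ->
  \sum_(s : column) u (bit s j) <= #|{: column}|%:R * (pair_const * avg u).
Proof.
move=> u0; have [j' jj] : exists j' : cell, j != j'.
  by exists (~~ j.1, j.2); case: j => -[].
have := @sum_col_pair u (fun=> 1) j j' jj u0 (fun=> ler01).
have -> : avg (fun=> 1) = 1 by rewrite /avg !mulr1 addrC subrK.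
by rewrite mulr1; under eq_bigr do rewrite mulr1.
Qed.

Section blocks.
Variable n : nat.

Definition codebook := {ffun 'I_n -> column}.

Lemma sum_codebook_pair (u v : 'I_n -> bool -> R) (j j' : cell) : j != j' ->
  (forall i x, 0 <= u i x) -> (forall i x, 0 <= v i x) ->
  \sum_(w : codebook) (\prod_i u i (bit (w i) j)) * (\prod_i v i (bit (w i) j')) <=
  #|{: codebook}|%:R *
    (pair_const ^+ n * ((\prod_i avg (u i)) * (\prod_i avg (v i)))).
Proof.
move=> jj u0 v0.
rewrite (eq_bigr (fun w : codebook =>
    \prod_i (u i (bit (w i) j) * v i (bit (w i) j')))); last first.
  by move=> w _; rewrite big_split.
rewrite -(bigA_distr_bigA (fun i s => u i (bit s j) * v i (bit s j'))).
have -> : #|{: codebook}|%:R *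
    (pair_const ^+ n * ((\prod_i avg (u i)) * (\prod_i avg (v i)))) =
    \prod_(i < n) (#|{: column}|%:R * (pair_const * (avg (u i) * avg (v i)))).
  rewrite big_split/= prodr_const card_ord big_split/= prodr_const card_ord.
  by rewrite big_split/= card_ffun card_ord natrX.
apply: ler_prod => i _; rewrite sumr_ge0/=; last by move=> s _; rewrite mulr_ge0.
exact: sum_col_pair.
Qed.

Lemma sum_codebook_single (u : 'I_n -> bool -> R) (j : cell) :
  (forall i x, 0 <= u i x) ->
  \sum_(w : codebook) (\prod_i u i (bit (w i) j)) <=
  #|{: codebook}|%:R * (pair_const ^+ n * \prod_i avg (u i)).
Proof.
move=> u0; rewrite -(bigA_distr_bigA (fun i s => u i (bit s j))).
have -> : #|{: codebook}|%:R * (pair_const ^+ n * \prod_i avg (u i)) =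
    \prod_(i < n) (#|{: column}|%:R * (pair_const * avg (u i))).
  rewrite big_split/= prodr_const card_ord big_split/= prodr_const card_ord.
  by rewrite card_ffun card_ord natrX.
apply: ler_prod => i _; rewrite sumr_ge0//=.
exact: sum_col_single.
Qed.

End blocks.
End code.
End permutation_code.

(** * Partition of [0, 1) into cells of given lengths *)

Section interval_partition.
Context {R : realType} (T : finType) (len : T -> R).
Hypothesis len0 : forall j, 0 <= len j.
Hypothesis len1 : \sum_j len j = 1.

Let P (m : nat) : R := \sum_(j | (enum_rank j < m)%N) len j.

Definition lower (j : T) : R := P (enum_rank j).

Let upperE j : lower j + len j = P (enum_rank j).+1.
Proof.
rewrite /lower /P [RHS](bigD1 j)//= addrC; congr (_ + _).
apply: eq_bigl => i; rewrite ltnS ltn_neqAle.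
by rewrite -(inj_eq enum_rank_inj) andbC.
Qed.

Let P_mono m m' : (m <= m')%N -> P m <= P m'.
Proof.
move=> mm; rewrite /P [leRHS](bigID (fun j => enum_rank j < m)%N)/=.
rewrite [X in _ <= X + _](eq_bigl (fun j => enum_rank j < m)%N) => [|j].
  by rewrite lerDl sumr_ge0.
by apply: andb_idl => /leq_trans; exact.
Qed.

Let P0 : P 0 = 0. Proof. by rewrite /P big_pred0. Qed.

Let PT : P #|T| = 1.
Proof. by rewrite /P -len1; apply: eq_bigl => j; rewrite ltn_ord. Qed.

Lemma interval_cover (w : R) : 0 <= w < 1 ->
  exists j, lower j <= w < lower j + len j.
Proof.
case/andP=> w0 w1.
have ex : exists m, w < P m by exists #|T|; rewrite PT.
(* The cell is the one whose upper end is the first partial sum exceeding [w]. *)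
case: (ex_minnP ex) => -[|m]; first by rewrite P0 ltNge w0.
move=> wm mmin.
have mT : (m < #|T|)%N by apply: mmin; rewrite PT.
exists (enum_val (Ordinal mT)); rewrite upperE /lower enum_valK wm andbT.
by rewrite leNgt; apply/negP => /mmin; rewrite ltnn.
Qed.

Lemma interval_disjoint j j' w : lower j <= w < lower j + len j ->
  lower j' <= w < lower j' + len j' -> j = j'.
Proof.
rewrite !upperE /lower => /andP[a b] /andP[a' b'].
apply/enum_rank_inj/val_inj/eqP; rewrite eqn_leq; apply/andP; split;
  rewrite leqNgt; apply/negP => /P_mono h; lra.
Qed.

Lemma interval_unit j w : lower j <= w < lower j + len j -> 0 <= w < 1.
Proof.
rewrite upperE /lower => /andP[a b].
have := P_mono (leq0n (enum_rank j)); rewrite P0 => h1.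
have := P_mono (ltn_ord (enum_rank j)); rewrite PT => h2.
by apply/andP; split; lra.
Qed.

Definition cells (B : pred T) : set (measurableTypeR R) :=
  [set w | exists2 j, B j & lower j <= w < lower j + len j].

Let cellsE B : cells B = \big[setU/set0]_(j | B j) `[lower j, lower j + len j[%classic.
Proof.
apply/seteqP; split => w.
  case=> j Bj wj; rewrite (bigD1 j)//=; left.
  by rewrite /= in_itv.
elim/big_rec: _ => //= j A Bj IH [|/IH//].
by rewrite in_itv/= => wj; exists j.
Qed.

Lemma measurable_cells B : measurable (cells B).
Proof. by rewrite cellsE; apply: bigsetU_measurable => j _; exact: measurable_itv. Qed.

Lemma lebesgue_cells (B : pred T) :
  lebesgue_measure (cells B) = (\sum_(j | B j) len j)%:E.
Proof.
pose I j : set (measurableTypeR R) := `[lower j, lower j + len j[%classic.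
have mI j : measurable (I j) by exact: measurable_itv.
have lI j : lebesgue_measure (I j) = (len j)%:E.
  rewrite lebesgue_measure_itv/= lte_fin ltrDl.
  case: ifP => [_|/negbT]; first by rewrite -EFinB addrAC subrr add0r.
  by rewrite -leNgt => l0; congr EFin; apply/eqP; rewrite eq_le l0 len0.
have ind w : (\1_(cells B) w)%:E =
    (\sum_(j <- [seq j <- enum T | B j]) (\1_(I j) w)%:E)%E :> \bar R.
  rewrite big_filter big_enum_cond/=.
  have [[j Bj wj]|nw] := pselect (cells B w).
    rewrite indicE mem_set/=; last by exists j.
    rewrite (bigD1 j)//= indicE mem_set/=; last by rewrite /I/= in_itv.
    rewrite big1 ?adde0// => i /andP[_ ij]; rewrite indicE memNset// /I/= in_itv/=.
    by move=> wi; move/eqP: ij; apply; exact: interval_disjoint wi wj.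
  rewrite indicE memNset//= big1// => j Bj; rewrite indicE memNset// /I/= in_itv/=.
  by move=> wj; apply: nw; exists j.
transitivity (\int[lebesgue_measure]_w (\1_(cells B) w)%:E)%E.
  by rewrite integral_indic ?setIT//; exact: measurable_cells.
under eq_integral do rewrite ind.
rewrite ge0_integral_sum//; last by move=> j; apply/measurable_EFinP; exact: measurable_indic.
rewrite big_filter big_enum_cond/= -sumEFin; apply: eq_bigr => j Bj.
by rewrite integral_indic// setIT; exact: lI.
Qed.

End interval_partition.

(** * Gallager's bound over codebooks, at a fixed output *)

Section gallager_finite.
Context {R : realType}.

Lemma powR_prod (I : finType) (x : I -> R) (s : R) : (forall i, 0 <= x i) ->
  (\prod_i x i) `^ s = \prod_i (x i `^ s).
Proof.
move=> x0; suff [] : 0 <= \prod_i x i /\ (\prod_i x i) `^ s = \prod_i (x i `^ s).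
  by [].
elim/big_rec2 : _ => [|i a b _ [b0 IH]]; first by rewrite powR1.
by rewrite mulr_ge0// powRM// IH.
Qed.

Lemma powR_young (x z rho : R) : 0 < rho < 1 -> 0 <= x -> 0 <= z ->
  x `^ rho * z `^ (1 - rho) <= rho * x + (1 - rho) * z.
Proof.
case/andP=> r0 r1 x0 z0.
have r1' : 0 < 1 - rho by rewrite subr_gt0.
have := @conjugate_powR _ (x `^ rho) (z `^ (1 - rho)) rho^-1 (1 - rho)^-1.
rewrite !powR_ge0 !invr_gt0 !invrK -!powRrM !divff ?gt_eqF//.
rewrite !powRr1// (mulrC x) (mulrC z); apply => //; ring.
Qed.

Variables (N : nat) (k : bool -> nat).
Hypothesis N1 : (1 < N)%N.
Hypothesis kN : forall g, (k g <= N)%N.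
Variables (q K0 : R).
Hypotheses (q01 : 0 <= q <= 1) (K01 : 1 <= K0).
Hypothesis k1K : forall g, (k g)%:R <= N%:R * (K0 * q).
Hypothesis k0K : forall g, (N - k g)%:R <= N%:R * (K0 * (1 - q)).
Variable n : nat.

Let K := pair_const N K0.
Let m : R := (#|{: cell N}|.-1)%:R.

(* Gallager's bound at a fixed output: the average over codebooks of
   u(X_j) (sum over competitors of u)^rho, by the tangent line of z |-> z^rho at
   the mean. *)
Lemma codebook_gallager (u : 'I_n -> bool -> R) (j : cell N) (rho : R) :
  0 < rho < 1 -> (forall i x, 0 <= u i x) ->
  \sum_(w : codebook N n) (\prod_i u i (bit k (w i) j)) *
     (\sum_(j' | j' != j) \prod_i u i (bit k (w i) j')) `^ rho <=
  #|{: codebook N n}|%:R *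
    (K ^+ n * (m `^ rho * \prod_i (avg q (u i) `^ (1 + rho)))).
Proof.
move=> rho01 u0; have /andP[r0 r1] := rho01.
pose U (w : codebook N n) j' := \prod_i u i (bit k (w i) j').
have U0 w j' : 0 <= U w j' by exact: prodr_ge0.
pose V := \prod_i avg q (u i).
have a0 i : 0 <= avg q (u i) by exact: avg_ge0.
have V0 : 0 <= V by exact: prodr_ge0.
pose C := #|{: codebook N n}|%:R * K ^+ n : R.
have K0' : 0 <= K.
  by rewrite (le_trans _ (K0_le_pair_const N1 K01))// exprn_ge0// (le_trans _ K01).
have C0 : 0 <= C by rewrite mulr_ge0// exprn_ge0.
have single : \sum_w U w j <= C * V.
  by rewrite /C -mulrA; exact: sum_codebook_single.
have pair : \sum_w U w j * (\sum_(j' | j' != j) U w j') <= m * (C * (V * V)).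
  under eq_bigr do rewrite mulr_sumr.
  rewrite exchange_big/= /m -(cardC1 j) mulr_natl -sumr_const.
  rewrite [leRHS](eq_bigl (fun j' => j' != j)); last by move=> j'; rewrite inE.
  apply: ler_sum => j' jj; rewrite /C -mulrA.
  by apply: sum_codebook_pair => //; rewrite eq_sym.
have m0 : 0 < m.
  rewrite ltr0n /cell card_prod card_bool card_ord -subn1 subn_gt0.
  by rewrite (leq_trans N1)// leq_pmull.
have -> : \prod_i (avg q (u i) `^ (1 + rho)) = V `^ (1 + rho).
  by rewrite powR_prod.
rewrite mulrA -/C.
(* If [V] vanishes there is no tangent point, but then the codeword of [j] has weight 0 in every
   codebook. *)
move: V0; rewrite le_eqVlt => /predU1P[V0|V0].
  have Uj w : U w j = 0.
    apply/eqP; rewrite eq_le U0 andbT.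
    apply: (@le_trans _ _ (\sum_w U w j)); last by rewrite (le_trans single)// -V0 mulr0.
    by rewrite (bigD1 w)//= lerDl sumr_ge0.
  rewrite big1; last by move=> w _; rewrite [X in X * _]Uj mul0r.
  by rewrite mulr_ge0// mulr_ge0// powR_ge0.
(* Up to [K ^+ n], the mean of the competitors' sum. Multiplying by [z ^ (1 - rho)] makes Young's
   inequality linear in that sum; the pair and single averages then recombine, with weights [rho]
   and [1 - rho], to the same value. *)
pose z := m * V; have z0 : 0 < z by exact: mulr_gt0.
have zr : 0 < z `^ (1 - rho) by exact: powR_gt0.
rewrite -(ler_pM2r zr) mulr_suml.
apply: (@le_trans _ _ (\sum_w (rho * (U w j * (\sum_(j' | j' != j) U w j')) +
    (1 - rho) * z * U w j))).
  apply: ler_sum => w _; rewrite -[leLHS]mulrA.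
  rewrite [leRHS](_ : _ = U w j *
    (rho * (\sum_(j' | j' != j) U w j') + (1 - rho) * z)); last by ring.
  apply: ler_wpM2l; first exact: U0.
  apply: powR_young => //; last exact: ltW.
  by apply: sumr_ge0 => j' _; exact: U0.
rewrite big_split/= -!mulr_sumr.
apply: (@le_trans _ _ (rho * (m * (C * (V * V))) + (1 - rho) * z * (C * V))).
  by apply: lerD; apply: ler_wpM2l => //; rewrite ?mulr_ge0// ?subr_ge0 ltW.
rewrite le_eqVlt; apply/orP; left; apply/eqP.
have zz : z `^ rho * z `^ (1 - rho) = z.
  rewrite -powRD; last by rewrite (gt_eqF z0) implybT.
  by rewrite addrCA subrr addr0 powRr1// ltW.
have -> : C * (m `^ rho * V `^ (1 + rho)) * z `^ (1 - rho) =
   C * V * (z `^ rho * z `^ (1 - rho)).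
  rewrite powRD; last by rewrite (gt_eqF V0) implybT.
  rewrite powRr1 ?ltW// /z (powRM rho)// ?ltW//; ring.
by rewrite zz /z; ring.
Qed.

End gallager_finite.

(** * The Gallager integral and bounds on [E0] *)

Section gallager_function.
Context {R : realType} {d : measure_display} {Y : measurableType d}.
Variable mu : {sigma_finite_measure set Y -> \bar R}.
Variable W : R -> bool -> Y -> R.
Hypothesis WC : is_channel mu W.
Variable q : R.
Hypothesis q01 : 0 < q < 1.

Let q0 : 0 < q. Proof. by case/andP: q01. Qed.
Let q1 : 0 < 1 - q. Proof. by rewrite subr_gt0; case/andP: q01. Qed.
Let qq : 0 <= q <= 1. Proof. by case/andP: q01 => ? ?; rewrite !ltW. Qed.

Lemma powR_inv_cancel (a rho : R) : 0 <= a -> 0 < rho ->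
  (a `^ (1 + rho)^-1) `^ (1 + rho) = a.
Proof. by move=> a0 r0; rewrite -powRrM mulVf ?powRr1// gt_eqF// addr_gt0. Qed.

Definition power_mean (rho a1 a0 : R) : R :=
  (q * a1 `^ (1 + rho)^-1 + (1 - q) * a0 `^ (1 + rho)^-1) `^ (1 + rho).

(** Convexity of [x ^ (1 + rho)]; integrated, it bounds the Gallager integral by 1. *)
Lemma power_mean_le (rho a1 a0 : R) : 0 < rho -> 0 <= a1 -> 0 <= a0 ->
  power_mean rho a1 a0 <= q * a1 + (1 - q) * a0.
Proof.
move=> r0 a10 a00.
have p1 : 1 <= 1 + rho by rewrite lerDl ltW.
have q1' : q <= 1 by case/andP: q01 => _ /ltW.
have := convex_powR p1 (Itv01 (ltW q0) q1') (x := a1 `^ (1 + rho)^-1)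
  (y := a0 `^ (1 + rho)^-1).
rewrite !inE/= !in_itv/= !andbT !powR_ge0 => /(_ isT isT).
rewrite !convRE/= !powR_inv_cancel//.
Qed.

(** Superadditivity of [x ^ (1 + rho)], with [q ^ (1 + rho) >= c ^ rho * q] for the minimum [c]. It
    keeps the Gallager integral away from 0, so that its logarithm is genuine, and yields
    [E0_le]. *)
Lemma power_mean_ge (rho a1 a0 : R) : 0 < rho -> 0 <= a1 -> 0 <= a0 ->
  Num.min q (1 - q) `^ rho * (q * a1 + (1 - q) * a0) <= power_mean rho a1 a0.
Proof.
move=> r0 a10 a00; rewrite /power_mean.
set A := q * a1 `^ _; set B := (1 - q) * a0 `^ _.
have A0 : 0 <= A by rewrite mulr_ge0 ?powR_ge0// ltW.
have B0 : 0 <= B by rewrite mulr_ge0 ?powR_ge0// ltW.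
set c := Num.min q (1 - q).
have c0 : 0 < c by rewrite lt_min q0 q1.
have rle x y : 0 <= x -> x <= y -> x `^ rho <= y `^ rho.
  by move=> x0 xy; apply: ge0_ler_powR; rewrite ?nnegrE ?(ltW r0)// (le_trans x0).
have pw x : 0 <= x -> x `^ (1 + rho) = x * x `^ rho.
  move=> x0; rewrite powRD ?powRr1//.
  by rewrite (_ : 1 + rho == 0 = false)//; apply/gt_eqF/addr_gt0.
have H x a : 0 < x -> c <= x -> 0 <= a ->
    c `^ rho * (x * a) <= (x * a `^ (1 + rho)^-1) `^ (1 + rho).
  move=> x0 cx aa; rewrite powRM ?powR_ge0 ?(ltW x0)// powR_inv_cancel// mulrA.
  apply: ler_wpM2r => //; rewrite pw ?(ltW x0)// mulrC ler_wpM2l ?(ltW x0)//.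
  by apply: rle => //; exact: ltW.
apply: (@le_trans _ _ (A `^ (1 + rho) + B `^ (1 + rho))).
  rewrite mulrDr; apply: lerD; apply: H => //; first by rewrite ge_min lexx.
  by rewrite ge_min lexx orbT.
rewrite !pw ?addr_ge0// mulrDl; apply: lerD; apply: ler_wpM2l => //;
  by apply: rle; rewrite // ?lerDl ?lerDr.
Qed.

Variable rho : R.
Hypothesis rho01 : 0 < rho < 1.
Let r0 : 0 < rho. Proof. by case/andP: rho01. Qed.

Let W0 x y : 0 <= W q x y. Proof. exact: (channel_ge0 WC). Qed.

Definition gmean (y : Y) : R := power_mean rho (W q true y) (W q false y).

Lemma measurable_gmean : measurable_fun setT gmean.
Proof.
have mW x : measurable_fun setT (fun y => W q x y `^ (1 + rho)^-1).
  apply: (measurableT_comp (f := fun z : R => z `^ (1 + rho)^-1)).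
    exact: measurable_powR.
  exact: (channel_measurable WC).
apply: (measurableT_comp (f := fun z : R => z `^ (1 + rho))).
  exact: measurable_powR.
by apply: measurable_funD; exact: measurable_funM.
Qed.

Lemma gmean_ge0 y : 0 <= gmean y. Proof. exact: powR_ge0. Qed.

Let mo := measurable_output_density WC q qq.
Let o1 := integral_output_density WC qq qq.
Let mh := measurable_gmean.

Lemma integral_gmean_le1 : (\int[mu]_y (gmean y)%:E <= 1)%E.
Proof.
rewrite -o1; apply: ge0_le_integral => //.
- by move=> y _; rewrite lee_fin gmean_ge0.
- exact/measurable_EFinP.
- exact/measurable_EFinP.
- by move=> y _; rewrite lee_fin output_densityE; exact: power_mean_le.
Qed.

Lemma integral_gmean_fin : (\int[mu]_y (gmean y)%:E)%E \is a fin_num.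
Proof.
rewrite ge0_fin_numE; first by rewrite (le_lt_trans integral_gmean_le1)// ltry.
by apply: integral_ge0 => y _; rewrite lee_fin gmean_ge0.
Qed.

Lemma integral_gmean_ge : ((Num.min q (1 - q) `^ rho)%:E <= \int[mu]_y (gmean y)%:E)%E.
Proof.
rewrite -[leLHS]mule1 -o1 -ge0_integralZl//; last 3 first.
- exact/measurable_EFinP.
- by move=> y _; rewrite lee_fin (output_density_ge0 WC).
- by rewrite lee_fin powR_ge0.
apply: ge0_le_integral => //.
- by move=> y _; rewrite mule_ge0// lee_fin ?powR_ge0// (output_density_ge0 WC).
- by apply/measurable_funeM/measurable_EFinP.
- exact/measurable_EFinP.
- by move=> y _; rewrite -EFinM lee_fin output_densityE; exact: power_mean_ge.
Qed.

Lemma E0_exp : (\int[mu]_y (gmean y)%:E)%E = (expR (- (ln 2 * E0 mu W rho q)))%:E.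
Proof.
have l2 := @ln2_gt0 R.
rewrite -(fineK integral_gmean_fin); congr EFin.
have Z0 : 0 < fine (\int[mu]_y (gmean y)%:E)%E.
  rewrite -lte_fin fineK ?integral_gmean_fin//; apply: lt_le_trans integral_gmean_ge.
  by rewrite lte_fin powR_gt0// lt_min q0 q1.
have -> : E0 mu W rho q = - log2 (fine (\int[mu]_y (gmean y)%:E)%E) by [].
rewrite /log2 mulrN opprK mulrC divfK ?gt_eqF//.
by rewrite lnK.
Qed.

(** Being linear in [rho], this bound makes the supremum in [Er] finite and keeps a near-optimal
    [rho] away from 0. *)
Lemma E0_le : E0 mu W rho q <= rho * log2 (Num.min q (1 - q))^-1.
Proof.
have l2 := @ln2_gt0 R.
have c0 : 0 < Num.min q (1 - q) by rewrite lt_min q0 q1.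
have := integral_gmean_ge; rewrite E0_exp lee_fin /powR gt_eqF// ler_expR => h.
rewrite /log2 lnV ?posrE//.
rewrite mulrA ler_pdivlMr// mulrC; lra.
Qed.

End gallager_function.

(** * Maximum likelihood decoding, averaged over codebooks *)

Section average_error.
Context {R : realType} {d : measure_display} {Y : measurableType d}.
Variable mu : {sigma_finite_measure set Y -> \bar R}.
Variable W : R -> bool -> Y -> R.
Hypothesis WC : is_channel mu W.
Variable q : R.
Hypothesis q01 : 0 < q < 1.

Variables (N : nat) (k : bool -> nat).
Hypothesis N1 : (1 < N)%N.
Hypothesis kN : forall g, (k g <= N)%N.
Variable K0 : R.
Hypothesis K01 : 1 <= K0.
Hypothesis k1K : forall g, (k g)%:R <= N%:R * (K0 * q).
Hypothesis k0K : forall g, (N - k g)%:R <= N%:R * (K0 * (1 - q)).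
Variable n : nat.

Let qq : 0 <= q <= 1. Proof. by case/andP: q01 => ? ?; rewrite !ltW. Qed.

Definition letter (w : codebook N n) (j : cell N) (i : 'I_n) : Y -> R :=
  W q (bit k (w i) j).

Definition likelihood (w : codebook N n) (j : cell N) : n.-tuple Y -> R :=
  tuple_density (letter w j).

(** Strict, so that at most one cell wins; a tie for the maximum counts as an error. *)
Definition wins (w : codebook N n) (j : cell N) (t : n.-tuple Y) : bool :=
  [forall j', (j' != j) ==> (likelihood w j' t < likelihood w j t)].

Lemma letter_ge0 w j i y : 0 <= letter w j i y.
Proof. exact: (channel_ge0 WC). Qed.

Lemma measurable_letter w j i : measurable_fun setT (letter w j i).
Proof. exact: (channel_measurable WC). Qed.

Lemma integral_letter w j i : (\int[mu]_y (letter w j i y)%:E = 1)%E.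
Proof. exact: (channel_integral WC). Qed.

Lemma likelihood_ge0 w j t : 0 <= likelihood w j t.
Proof. by apply: tuple_density_ge0 => i y; exact: letter_ge0. Qed.

Lemma measurable_likelihood w j : measurable_fun setT (likelihood w j).
Proof. by apply: measurable_tuple_density => i; exact: measurable_letter. Qed.

Lemma measurable_wins w j : measurable [set t | wins w j t].
Proof.
rewrite (_ : [set t | _] = \big[setI/setT]_(j' | j' != j)
    [set t | likelihood w j' t < likelihood w j t]).
  apply: bigsetI_measurable => j' _.
  have := measurable_fun_ltr (measurable_likelihood w j') (measurable_likelihood w j).
  by move=> /(_ measurableT [set true] I); rewrite setTI.
apply/seteqP; split => t /=.
  move=> /forallP wt; elim/big_rec: _ => // j' A jj At; split => //=.
  by have /implyP := wt j'; apply.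
move=> H; apply/forallP => j'; apply/implyP => jj.
by move: H; rewrite (bigD1 j')//= => -[].
Qed.

Variable rho : R.
Hypothesis rho01 : 0 < rho < 1.

Let s := (1 + rho)^-1.

Let u (t : n.-tuple Y) (i : 'I_n) (x : bool) : R := W q x (tnth t i) `^ s.

Let rho0 : 0 < rho. Proof. by case/andP: rho01. Qed.

Lemma likelihood_powR w j t :
  likelihood w j t `^ s = \prod_i u t i (bit k (w i) j).
Proof. by rewrite /likelihood /tuple_density powR_prod// => i; exact: letter_ge0. Qed.

(** Without a win some competitor has likelihood at least [L], so [L ^ s] is at most the sum of the
    competitors' powers; and [L = L ^ s * (L ^ s) ^ rho] because [s * (1 + rho) = 1]. *)
Lemma error_pointwise w j t :
  likelihood w j t * \1_(~` [set t | wins w j t]) t <=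
  (\prod_i u t i (bit k (w i) j)) *
  (\sum_(j' | j' != j) \prod_i u t i (bit k (w i) j')) `^ rho.
Proof.
rewrite indicE; case: (boolP (wins w j t)) => wt.
  rewrite memNset//=.
  by rewrite mulr0 mulr_ge0 ?powR_ge0// prodr_ge0// => i _; exact: powR_ge0.
rewrite mem_set//=; last exact/negP.
move: wt; rewrite negb_forall => /existsP[j']; rewrite negb_imply -leNgt.
case/andP=> jj Ljj; rewrite mulr1 -likelihood_powR.
set L := likelihood w j t; have L0 : 0 <= L by exact: likelihood_ge0.
set Z := \sum_(_ | _) _.
have LZ : L `^ s <= Z.
  rewrite /Z (bigD1 j')//= -likelihood_powR.
  apply: (@le_trans _ _ (likelihood w j' t `^ s)).
    apply: ge0_ler_powR; rewrite ?nnegrE ?likelihood_ge0//.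
    by rewrite invr_ge0 addr_ge0// ltW.
  rewrite lerDl sumr_ge0// => i _; rewrite prodr_ge0// => i' _; exact: powR_ge0.
apply: (@le_trans _ _ (L `^ s * (L `^ s) `^ rho)).
  have -> : L `^ s * (L `^ s) `^ rho = L.
    rewrite -[RHS](powR_inv_cancel L0 rho0) -/s powRD ?powRr1 ?powR_ge0//.
    by rewrite (_ : 1 + rho == 0 = false)//; apply/gt_eqF/addr_gt0.
  by [].
apply: ler_wpM2l; first exact: powR_ge0.
by apply: ge0_ler_powR; rewrite ?nnegrE ?powR_ge0// ?(ltW rho0)// (le_trans _ LZ)// powR_ge0.
Qed.

(** The codebook average is taken under the integral, where [codebook_gallager] applies; the
    resulting bound is a product over letters and integrates factor by factor. *)
Lemma average_error j :
  (\sum_(w : codebook N n) \int[tuple_measure mu n]_t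
     (likelihood w j t * \1_(~` [set t | wins w j t]) t)%:E <=
   (#|{: codebook N n}|%:R * (pair_const N K0 ^+ n *
     ((#|{: cell N}|.-1)%:R `^ rho *
      expR (- (ln 2 * E0 mu W rho q)) ^+ n)))%:E)%E.
Proof.
pose C : R := #|{: codebook N n}|%:R * (pair_const N K0 ^+ n *
     (#|{: cell N}|.-1)%:R `^ rho).
have C0 : 0 <= C.
  rewrite mulr_ge0// mulr_ge0 ?powR_ge0// exprn_ge0//.
  by rewrite (le_trans _ (K0_le_pair_const N1 K01))// exprn_ge0// (le_trans _ K01).
have mL w : measurable_fun setT (fun t =>
    (likelihood w j t * \1_(~` [set t | wins w j t]) t)%:E).
  apply/measurable_EFinP/measurable_funM; first exact: measurable_likelihood.
  by apply: measurable_indic; apply: measurableC; exact: measurable_wins.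
have L0 w t : (0 <= (likelihood w j t * \1_(~` [set t | wins w j t]) t)%:E)%E.
  by rewrite lee_fin mulr_ge0// likelihood_ge0.
have mg (i : 'I_n) := measurable_gmean WC q01 rho.
rewrite -ge0_integral_sum//.
apply: (@le_trans _ _ (\int[tuple_measure mu n]_t
    (C%:E * (\prod_(i < n) gmean W q rho (tnth t i))%:E))%E).
  apply: ge0_le_integral => //.
  - by move=> t _; apply: sume_ge0.
  - exact: emeasurable_sum.
  - by apply/measurable_funeM/measurable_EFinP; exact: (measurable_prod_tnth mg).
  move=> t _; rewrite sumEFin -EFinM lee_fin.
  apply: (@le_trans _ _ (\sum_(w : codebook N n) (\prod_i u t i (bit k (w i) j)) *
     (\sum_(j' | j' != j) \prod_i u t i (bit k (w i) j')) `^ rho)).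
    by apply: ler_sum => w _; exact: error_pointwise.
  rewrite /C -!mulrA.
  by apply: codebook_gallager => // i x; exact: powR_ge0.
rewrite ge0_integralZl//; last 2 first.
- by apply/measurable_EFinP; exact: (measurable_prod_tnth mg).
- by move=> t _; rewrite lee_fin prodr_ge0// => i _; exact: gmean_ge0.
rewrite (integral_tuple_prod mu (f := fun _ : 'I_n => gmean W q rho) mg); last first.
  by move=> i y; exact: gmean_ge0.
rewrite (eq_bigr (fun=> (expR (- (ln 2 * E0 mu W rho q)))%:E)); last first.
  by move=> i _; exact: E0_exp.
rewrite prodEFin prodr_const card_ord -EFinM lee_fin /C.
by rewrite -!mulrA.
Qed.

End average_error.

(** * The random code as a search strategy *)

Section uniform_nat.
Context {R : realType}.
Variable m : nat.

(** The codebook is drawn as an index in [nat]: all subsets of [nat] are measurable, so the joint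
    measurability asked of a strategy reduces to that of countably many sections. *)
Definition uniform_nat : set nat -> \bar R :=
  mscale ((m.+1)%:R^-1)%:nng (msum (fun k : nat => \d_k) m.+1).

HB.instance Definition _ := Measure.on uniform_nat.

Let uniform_natT : uniform_nat [set: nat] = 1%E.
Proof.
rewrite /uniform_nat /mscale/= /msum/=.
rewrite (eq_bigr (fun=> 1%:E)) => [|i _]; last by rewrite diracE in_setT.
by rewrite sumEFin sumr_const card_ord -EFinM mulVf// pnatr_eq0.
Qed.

HB.instance Definition _ :=
  Measure_isProbability.Build _ _ _ uniform_nat uniform_natT.

Lemma integral_uniform_nat (f : nat -> \bar R) : (forall u, 0 <= f u)%E ->
  (\int[uniform_nat]_u f u = ((m.+1)%:R^-1)%:E * \sum_(u < m.+1) f u)%E.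
Proof.
move=> f0; have mf : measurable_fun setT f by [].
rewrite ge0_integral_mscale// ge0_integral_measure_sum//; congr (_ * _)%E.
by apply: eq_bigr => i _; rewrite integral_dirac// diracE in_setT mul1e.
Qed.

End uniform_nat.

Section countable_sections.
Context {d : measure_display} {T : measurableType d}.

Lemma measurable_nat_sections (A : nat -> set T) : (forall u, measurable (A u)) ->
  measurable [set p : nat * T | A p.1 p.2].
Proof.
move=> mA; rewrite (_ : [set p | _] = \bigcup_u ([set u] `*` A u)).
  by apply: bigcup_measurable => u _; exact: measurableX.
by apply/seteqP; split => [[u t] Aut|[u t] [v _ [/= -> //]]]; exists u.
Qed.

Lemma measurable_fun_nat_sections d' (T' : measurableType d') (f : nat -> T -> T') :
  (forall u, measurable_fun setT (f u)) ->
  measurable_fun setT (fun p : nat * T => f p.1 p.2).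
Proof.
move=> mf _ B mB; rewrite setTI.
apply: (@measurable_nat_sections (fun u => f u @^-1` B)) => u.
by rewrite -[X in measurable X]setTI; exact: mf.
Qed.

End countable_sections.

Section code_strategy.
Context {R : realType} {d : measure_display} {Y : measurableType d}.
Variable mu : {sigma_finite_measure set Y -> \bar R}.
Variable W : R -> bool -> Y -> R.
Hypothesis WC : is_channel mu W.
Variable q : R.
Hypothesis q01 : 0 < q < 1.
Variables (N : nat) (k : bool -> nat).
Hypothesis N1 : (1 < N)%N.
Hypothesis kN : forall g, (k g <= N)%N.
Variable K0 : R.
Hypothesis K01 : 1 <= K0.
Hypothesis k1K : forall g, (k g)%:R <= N%:R * (K0 * q).
Hypothesis k0K : forall g, (N - k g)%:R <= N%:R * (K0 * (1 - q)).
Variable n : nat.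

Variables (len : cell N -> R) (delta : R).
Hypothesis len0 : forall j, 0 <= len j.
Hypothesis len1 : \sum_j len j = 1.
Hypothesis len_delta : forall j, len j <= 2 * delta.
Hypothesis len_bit : forall c : column N, \sum_(j | bit k c j) len j = q.

Let default : codebook N n := [ffun=> (1%g, 1%g)].
Let code (u : nat) : codebook N n := nth default (enum {: codebook N n}) u.

Let sum_code (F : codebook N n -> \bar R) :
  (\sum_(u < #|{: codebook N n}|.-1.+1) F (code u) = \sum_w F w)%E.
Proof.
have c0 : (0 < #|{: codebook N n}|)%N by apply/card_gt0P; exists default.
rewrite prednK// -[RHS]big_enum/= (big_nth default) big_mkord.
by rewrite cardE.
Qed.

Let the_query (i : 'I_n) (u : nat) : set R := cells len (bit k (code u i)).

Let the_query_sub i u : the_query i u `<=` `[0, 1[.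
Proof.
by move=> w [j _ wj]; rewrite /= in_itv/=; exact: interval_unit len1 _ _ wj.
Qed.

Let the_query_measurable i :
  measurable [set uw : nat * measurableTypeR R | the_query i uw.1 uw.2].
Proof.
by apply: measurable_nat_sections => u; exact: measurable_cells.
Qed.

Let mid (j : cell N) : R := lower len j + len j / 2.

(** At most one indicator is nonzero, so this is the midpoint of the winning cell; with no winner it
    defaults to 0. *)
Let the_estimator (u : nat) (t : n.-tuple Y) : R :=
  \sum_j mid j * \1_([set t | wins W q k (code u) j t]) t.

Let the_estimator_measurable :
  measurable_fun setT (fun uy : nat * n.-tuple Y => the_estimator uy.1 uy.2).
Proof.
apply: (measurable_fun_nat_sections (f := the_estimator)) => u.
apply: measurable_sum => j; apply: measurable_funM => //.
by apply: measurable_indic; exact: (measurable_wins WC).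
Qed.

Definition code_strategy : nonadaptive_strategy R Y :=
  NonadaptiveStrategy (uniform_nat #|{: codebook N n}|.-1)
    the_query_sub the_query_measurable the_estimator_measurable.

Let the_query_size i u : query_size (s := code_strategy) i u = q.
Proof. by rewrite /query_size/= lebesgue_cells//= len_bit. Qed.

Let the_estimator_wins u t j : wins W q k (code u) j t -> the_estimator u t = mid j.
Proof.
move=> wj; rewrite /the_estimator (bigD1 j)//= big1 => [|j' jj].
  by rewrite indicE mem_set// mulr1 addr0.
rewrite indicE memNset ?mulr0// => /= wj'.
move: wj wj' => /forallP/(_ j') + /forallP/(_ j).
rewrite jj eq_sym jj/= => /lt_trans h /h; by rewrite ltxx.
Qed.

(** All queries have size exactly [q], so a target in cell [j] sends the codeword of [j] through the
    single channel [W q]. The average error has the same bound for every [j], hence for every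
    target. *)
Lemma code_strategy_resolution rho : 0 < rho < 1 ->
  has_resolution mu W code_strategy delta
    (pair_const N K0 ^+ n * ((#|{: cell N}|.-1)%:R `^ rho *
       expR (- (ln 2 * E0 mu W rho q)) ^+ n)).
Proof.
move=> rho01 w w01; have [j wj] := interval_cover len1 w01.
set eps := pair_const _ _ ^+ n * _.
pose nu := tuple_measure mu n.
have hit u (i : 'I_n) : (w \in the_query i u) = bit k (code u i) j.
  apply/idP/idP => [/set_mem [j' bj' wj']|bj]; last by apply/mem_set; exists j.
  by rewrite (interval_disjoint len0 wj wj').
have mL u := measurable_likelihood WC q01 k (code u) j.
have L0 u := likelihood_ge0 WC q01 k (code u) j.
have mw u := measurable_wins WC q01 k (code u) j.
pose err v := (\int[nu]_t (likelihood W q k v j t *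
    \1_(~` [set t | wins W q k v j t]) t)%:E)%E.
have err0 v : (0 <= err v)%E.
  by apply: integral_ge0 => t _; rewrite lee_fin mulr_ge0// (likelihood_ge0 WC q01).
have err1 v : (err v <= 1)%E.
  rewrite -(integral_tuple_density (measurable_letter WC q01 k v j)
    (letter_ge0 WC q01 k v j) (integral_letter WC q01 k v j)).
  have mLv := measurable_likelihood WC q01 k v j.
  apply: ge0_le_integral => //.
  - by move=> t _; rewrite lee_fin mulr_ge0// (likelihood_ge0 WC q01).
  - apply/measurable_EFinP/measurable_funM => //.
    by apply: measurable_indic; apply: measurableC; exact: (measurable_wins WC).
  - exact/measurable_EFinP.
  - move=> t _; rewrite lee_fin ler_piMr//; exact: (likelihood_ge0 WC q01).
have errf v : err v \is a fin_num.
  by rewrite ge0_fin_numE// (le_lt_trans (err1 v))// ltry.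
have succ u : ((1 - fine (err (code u)))%:E <=
    memoryless_prob mu
      (fun i : 'I_n =>
         W (query_size (s := code_strategy) i u) (w \in the_query i u))
      [set y | (`|the_estimator u y - w| <= delta)%R])%E.
  have -> : (fun i : 'I_n => W (query_size (s := code_strategy) i u) (w \in the_query i u)) =
      letter W q k (code u) j.
    by apply/funext => i; rewrite the_query_size hit.
  have mest : measurable [set y : n.-tuple Y | `|the_estimator u y - w| <= delta].
    have me : measurable_fun setT (fun y => `|the_estimator u y - w|).
      apply: measurableT_comp => //; apply: measurable_funB => //.
      apply: measurable_sum => j'; apply: measurable_funM => //.
      by apply: measurable_indic; exact: (measurable_wins WC).
    rewrite -[X in measurable X]setTI
      [X in _ `&` X](_ : _ = (fun y => `|the_estimator u y - w|) @^-1` `]-oo, delta]).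
      by apply: me => //; exact: measurable_itv.
    by apply/seteqP; split => y /=; rewrite in_itv.
  rewrite (memoryless_probE mu (measurable_letter WC q01 k (code u) j)
    (letter_ge0 WC q01 k (code u) j) mest).
  rewrite EFinB fineK// leeBlDr//.
  rewrite -(integral_tuple_density (measurable_letter WC q01 k (code u) j)
    (letter_ge0 WC q01 k (code u) j) (integral_letter WC q01 k (code u) j)).
  have mI (A : set (n.-tuple Y)) : measurable A ->
      measurable_fun setT (fun t => (likelihood W q k (code u) j t * \1_A t)%:E).
    move=> mA; apply/measurable_EFinP/measurable_funM; first exact: mL.
    exact: measurable_indic.
  rewrite /err -ge0_integralD//; last 4 first.
  - by move=> t _; rewrite lee_fin mulr_ge0// L0.
  - exact: mI.
  - by move=> t _; rewrite lee_fin mulr_ge0// L0.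
  - by apply: mI; apply: measurableC.
  apply: ge0_le_integral => //.
  - by move=> t _; rewrite lee_fin L0.
  - by apply/measurable_EFinP; exact: mL.
  - by apply: emeasurable_funD; apply: mI => //; apply: measurableC.
  move=> t _; rewrite -EFinD lee_fin -mulrDr ler_peMr//; first exact: L0.
  rewrite !indicE in_setC; case: (boolP (t \in [set t | wins W q k (code u) j t])) => wt.
    rewrite mem_set ?addr0//=; rewrite (the_estimator_wins (set_mem wt)).
    rewrite /mid ler_norml; have /andP[w1 w2] := wj.
    by have := len_delta j; move=> ld; apply/andP; split; lra.
  by rewrite lerDr.
have -> : success_prob mu W code_strategy delta w =
  ((#|{: codebook N n}|.-1.+1%:R^-1)%:E * \sum_(u < #|{: codebook N n}|.-1.+1)
    memoryless_prob mu
      (fun i : 'I_n => W (query_size (s := code_strategy) i (u : nat))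
         (w \in the_query i (u : nat)))
      [set y | (`|the_estimator u y - w| <= delta)%R])%E.
  apply: (@integral_uniform_nat R _ (fun u => memoryless_prob mu
    (fun i : 'I_n => W (query_size (s := code_strategy) i u) (w \in the_query i u))
    [set y | (`|the_estimator u y - w| <= delta)%R])) => u.
  by apply: le_trans (succ u); rewrite lee_fin subr_ge0 -lee_fin fineK.
have c0 : (0 < #|{: codebook N n}|)%N by apply/card_gt0P; exists default.
apply: (@le_trans _ _ ((#|{: codebook N n}|.-1.+1%:R^-1)%:E *
  \sum_(u < #|{: codebook N n}|.-1.+1) (1 - fine (err (code u)))%:E)%E); last first.
  by apply: lee_wpmul2l; [rewrite lee_fin invr_ge0|apply: lee_sum => u _; exact: succ].
rewrite sumEFin big_split/= sumr_const card_ord sumrN -EFinM lee_fin.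
have errsum : \sum_(u < #|{: codebook N n}|.-1.+1) fine (err (code u)) <=
    #|{: codebook N n}|%:R * eps.
  rewrite -lee_fin -sumEFin.
  apply: le_trans (average_error WC q01 N1 kN K01 k1K k0K n rho01 j).
  rewrite (sum_code (fun v => (fine (err v))%:E)).
  by apply: lee_sum => v _; rewrite fineK.
have cR : (0 : R) < #|{: codebook N n}|%:R by rewrite ltr0n.
rewrite prednK// in errsum *.
rewrite mulrBr mulVf ?gt_eqF// lerD2l lerN2 ler_pdivrMl//.
Qed.

End code_strategy.

(** * Cell counts and lengths of the two groups *)

Section parameters.
Context {R : realType}.

(* Both groups have N cells; the cell lengths of the two groups differ slightly
   so that every column queries a set of measure exactly [q]. *)
Definition group_count (q : R) (N : nat) (g : bool) : nat :=
  if g then (Num.truncn (q * N%:R) + 2)%N else (Num.truncn (q * N%:R) - 2)%N.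

(** With [t] the truncation of [q N] and counts [t + a], [t - a], the lengths [(a + f) / (2 a N)]
    and [(a - f) / (2 a N)] have total 1 and queried measure [(t + f) / N = q]. They stay below
    [(a + 1) / (2 a N)]: this is [3 / (4 N)] for [a = 2], whereas [a = 1] would need about
    [1 / delta] cells and leave no room for the factor 4/5. *)
Definition group_length (q : R) (N : nat) (g : bool) : R :=
  let f := q * N%:R - (Num.truncn (q * N%:R))%:R in
  if g then (2 + f) / (4 * N%:R) else (2 - f) / (4 * N%:R).

Variables (q : R) (N : nat).
Hypothesis q01 : 0 < q < 1.
Let c := Num.min q (1 - q).
Hypothesis N_large : 3 <= N%:R * c.

Let q0 : 0 < q. Proof. by case/andP: q01. Qed.
Let q1 : q < 1. Proof. by case/andP: q01. Qed.
Let cq : c <= q. Proof. by rewrite /c ge_min lexx. Qed.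
Let cq1 : c <= 1 - q. Proof. by rewrite /c ge_min lexx orbT. Qed.
Let c0 : 0 < c. Proof. by rewrite /c lt_min q0 subr_gt0. Qed.
Let NR0 : 0 < N%:R :> R.
Proof. by rewrite -(pmulr_lgt0 _ c0); apply: lt_le_trans N_large. Qed.

Let t := Num.truncn (q * N%:R).

Let t_itv : t%:R <= q * N%:R < t%:R + 1.
Proof. by rewrite natr1; apply: truncn_itv; rewrite mulr_ge0// ltW. Qed.

Let qN : 3 <= q * N%:R.
Proof. by rewrite (le_trans N_large)// mulrC ler_wpM2r// ltW. Qed.

Let q1N : 3 <= (1 - q) * N%:R.
Proof. by rewrite (le_trans N_large)// mulrC ler_wpM2r// ltW. Qed.

Let t2 : (2 <= t)%N.
Proof.
rewrite -(ler_nat R); case/andP: t_itv => a b; have := qN; lra.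
Qed.

Let tN : (t + 2 <= N)%N.
Proof.
rewrite -(ler_nat R) natrD; case/andP: t_itv => a b; have := q1N; lra.
Qed.

Lemma params_N1 : (1 < N)%N.
Proof. by rewrite (leq_trans _ tN)// addn2. Qed.

Lemma group_count_le g : (group_count q N g <= N)%N.
Proof.
case: g; rewrite /group_count -/t//.
by rewrite (leq_trans (leq_subr _ _))// (leq_trans _ tN)// leq_addr.
Qed.

(** Truncation costs at most 1 and the shift 2, so a count exceeds its ideal value by at most 3;
    relative to the rarer letter this is [3 / (N c)]. *)
Definition slack : R := 1 + 3 / (N%:R * c).

Lemma slack_ge1 : 1 <= slack.
Proof. by rewrite /slack lerDl divr_ge0// mulr_ge0// ltW. Qed.

Let count_real g : (group_count q N g)%:R = if g then t%:R + 2 else t%:R - 2 :> R.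
Proof. by case: g; rewrite /group_count -/t ?natrD// natrB. Qed.

Let slackE x : c <= x -> N%:R * x + 3 <= N%:R * (slack * x).
Proof.
move=> cx; have -> : N%:R * (slack * x) = N%:R * x + 3 * (x / c).
  by rewrite /slack; field; rewrite !gt_eqF.
by rewrite lerD2l ler_peMr// ler_pdivlMr// mul1r.
Qed.

Lemma group_count_true g : (group_count q N g)%:R <= N%:R * (slack * q).
Proof.
rewrite (le_trans _ (slackE cq))// count_real.
by case/andP: t_itv => a b; case: g; lra.
Qed.

Lemma group_count_false g :
  (N - group_count q N g)%:R <= N%:R * (slack * (1 - q)).
Proof.
rewrite (le_trans _ (slackE cq1))// natrB ?group_count_le// count_real.
by case/andP: t_itv => a b; case: g; lra.
Qed.

Let f := q * N%:R - t%:R.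
Let f01 : 0 <= f < 1. Proof. by case/andP: t_itv => a b; apply/andP; split; rewrite /f; lra. Qed.

Let N4 : 0 < 4 * N%:R :> R. Proof. by rewrite mulr_gt0. Qed.

Lemma group_length_ge0 g : 0 <= group_length q N g.
Proof.
case/andP: f01 => a b.
by case: g; rewrite /group_length -/t -/f divr_ge0 ?ltW//; lra.
Qed.

Lemma group_length_le g : group_length q N g <= 3 / (4 * N%:R).
Proof.
case/andP: f01 => a b.
by case: g; rewrite /group_length -/t -/f ler_wpM2r ?invr_ge0 ?(ltW N4)//; lra.
Qed.

Lemma group_length_sum : \sum_(j : cell N) group_length q N j.1 = 1.
Proof.
rewrite -(pair_bigA _ (fun g (a : 'I_N) => group_length q N g))/=.
under eq_bigr do rewrite sumr_const card_ord -mulr_natl.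
rewrite big_bool/= /group_length -/t -/f.
by field; rewrite gt_eqF.
Qed.

Lemma group_length_bit (s : column N) :
  \sum_(j | bit (group_count q N) s j) group_length q N j.1 = q.
Proof.
rewrite big_mkcond -(pair_bigA _ (fun g (a : 'I_N) =>
  if bit (group_count q N) s (g, a) then group_length q N g else 0))/=.
have E g : \sum_(a < N) (if bit (group_count q N) s (g, a) then group_length q N g else 0) =
    (group_count q N g)%:R * group_length q N g.
  rewrite /bit/= -(reindex_inj (@perm_inj _ (group_perm s g)) (P := xpredT)
    (F := fun a : 'I_N => if (a < group_count q N g)%N then group_length q N g else 0))/=.
  rewrite -big_mkcond (big_ord_narrow (group_count_le g)).
  by rewrite sumr_const card_ord mulr_natl.
under eq_bigr do rewrite E.
rewrite big_bool (count_real true) (count_real false) /group_length -/t -/f.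
rewrite /=; have -> : q = (t%:R + f) / N%:R by rewrite /f addrC subrK mulfK// gt_eqF.
by field; rewrite gt_eqF.
Qed.

(** Here [8 = 6 + 2]: the square of [slack] contributes 6, and [N / (N - 1) = 1 + 1 / (N - 1)]
    contributes 2, since [N c <= 2 (N - 1)]. *)
Lemma pair_const_le : pair_const N slack <= expR (8 / (N%:R * c)).
Proof.
have N1 := params_N1.
have N1R : 0 < (N.-1)%:R :> R by rewrite ltr0n -subn1 subn_gt0.
have c1 : c <= 1 by rewrite (le_trans cq)// ltW.
have -> : 8 / (N%:R * c) = 2%:R * (3 / (N%:R * c)) + 2 / (N%:R * c).
  by field; rewrite !gt_eqF.
rewrite /pair_const expRD expRM_natl.
apply: ler_pM.
- by rewrite exprn_ge0// (le_trans _ slack_ge1).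
- by rewrite divr_ge0.
- by apply: lerXn2r; rewrite ?nnegrE ?expR_ge0 ?(le_trans _ slack_ge1)// expR_ge1Dx.
apply: le_trans (expR_ge1Dx _).
have -> : N%:R / N.-1%:R = 1 + 1 / (N.-1)%:R :> R.
  have -> : N%:R = N.-1%:R + 1 :> R by rewrite natr1 prednK// ltnW.
  by field; rewrite gt_eqF.
rewrite lerD2l ler_pdivrMr// mulrAC ler_pdivlMr ?mulr_gt0// mul1r.
have -> : N%:R = N.-1%:R + 1 :> R by rewrite natr1 prednK// ltnW.
have N11 : 1 <= N.-1%:R :> R by rewrite ler1n -subn1 subn_gt0.
have : (N.-1%:R + 1) * c <= (N.-1%:R + 1) * 1 by apply: ler_wpM2l => //; lra.
lra.
Qed.

End parameters.

(** * Random coding with explicit thresholds *)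

Section random_coding.
Context {R : realType} {d : measure_display} {Y : measurableType d}.
Variable mu : {sigma_finite_measure set Y -> \bar R}.
Variable W : R -> bool -> Y -> R.
Hypothesis WC : is_channel mu W.

Lemma has_resolution_le (s : nonadaptive_strategy R Y) (delta eps eps' : R) :
  eps <= eps' -> has_resolution mu W s delta eps -> has_resolution mu W s delta eps'.
Proof.
move=> ee res w w01; apply: le_trans (res w w01).
by rewrite lee_fin lerD2l lerN2.
Qed.

(** Neither [delta0] nor the strategy depends on [rho], which can therefore be optimised afterwards,
    even as a function of [n]. *)
Lemma random_coding (q r beta : R) : 0 < q < 1 -> 0 < r -> 0 < beta ->
  exists2 delta0, 0 < delta0 & forall (n : nat) (delta : R),
    0 < delta < delta0 -> n%:R = log2 delta^-1 / r ->
    exists2 s : nonadaptive_strategy R Y, nqueries s = n &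
      forall rho, 0 < rho < 1 -> has_resolution mu W s delta
        (expR beta * ((4 / 5 / delta) `^ rho *
          expR (- (ln 2 * E0 mu W rho q)) ^+ n)).
Proof.
move=> q01 r0 beta0; have l2 := @ln2_gt0 R.
pose c := Num.min q (1 - q).
have c0 : 0 < c.
  by rewrite /c lt_min; case/andP: q01 => -> q1; rewrite subr_gt0.
(* The dependence loss is [expR (8 n / (N c))]. With [n = ln (1 / delta) / (r ln 2)] and
   [N > 3 / (8 delta)], its exponent is below [beta] once [delta ln (1 / delta) <= 2 e], which
   [delta < e ^ 2] ensures through [xlnx_bound]. *)
pose e := 3 * c * (ln 2 * r) * beta / 128.
have e0 : 0 < e by rewrite /e !(mulr_gt0, divr_gt0).
(* [1 / 40] keeps the [2 N - 1] competitors below [(4/5) / delta]; [c / 8] gives [N c >= 3], as the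
   two-group construction requires. *)
exists (Num.min (40^-1) (Num.min (c / 8) (e ^+ 2))).
  by rewrite !lt_min invr_gt0 divr_gt0// exprn_gt0// ltr0n.
move=> n delta; rewrite !lt_min => /andP[d0 /and3P[d40 dc de]] nE.
(* Cell lengths are at most [3 / (4 N)], so this choice keeps them below [2 * delta]. *)
pose N := (Num.truncn (3 / (8 * delta))).+1.
have d8 : 0 < 8 * delta by rewrite mulr_gt0.
have /andP[N1 N2] : (Num.truncn (3 / (8 * delta)))%:R <= 3 / (8 * delta) < N%:R.
  by apply: truncn_itv; rewrite divr_ge0// ltW.
have N0 : 0 < N%:R :> R by rewrite ltr0n.
have Nd : 3 < N%:R * (8 * delta) by rewrite -ltr_pdivrMr.
have N_large : 3 <= N%:R * c.
  apply: ltW; apply: (lt_trans Nd); rewrite ltr_pM2l//; lra.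
have gN1 := params_N1 q01 N_large.
have len_delta (j : cell N) : group_length q N j.1 <= 2 * delta.
  apply: (le_trans (group_length_le q01 N_large j.1)).
  by rewrite ler_pdivrMr ?mulr_gt0//; lra.
have len0 (j : cell N) : 0 <= group_length q N j.1 by exact: group_length_ge0.
exists (code_strategy WC q01 (group_count q N) n len0
  (group_length_sum q01 N_large)) => // rho rho01.
have res := code_strategy_resolution WC q01 gN1
  (group_count_le q01 N_large) (slack_ge1 N q01)
  (group_count_true q01 N_large) (group_count_false q01 N_large) n len0
  (group_length_sum q01 N_large) len_delta
  (group_length_bit q01 N_large) rho01.
apply: (has_resolution_le _ res).
have K0 : 0 <= pair_const N (slack q N).
  apply: le_trans (K0_le_pair_const gN1 (slack_ge1 N q01)).
  by rewrite exprn_ge0// (le_trans _ (slack_ge1 N q01)).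
apply: ler_pM.
- exact: exprn_ge0.
- by rewrite mulr_ge0 ?powR_ge0// exprn_ge0// expR_ge0.
- apply: (@le_trans _ _ (expR (8 / (N%:R * c)) ^+ n)).
    by apply: lerXn2r; rewrite ?nnegrE ?expR_ge0//; exact: pair_const_le.
  rewrite -expRM_natl ler_expR.
  have Nc : 0 < N%:R * c by rewrite mulr_gt0.
  have lr : 0 < ln 2 * r by rewrite mulr_gt0.
  have -> : n%:R = - ln delta / (ln 2 * r).
    by rewrite nE /log2 lnV ?posrE//; field; rewrite !gt_eqF.
  have sd : Num.sqrt delta <= e.
    by rewrite -[leRHS](ger0_norm (ltW e0)) -sqrtr_sqr ler_wsqrtr// ltW.
  have xl : delta * - ln delta <= 2 * e.
    have d01 : 0 <= delta <= 1 by apply/andP; split; lra.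
    have := xlnx_bound d01; rewrite ler_norml => /andP[xl _]; lra.
  rewrite mulrA ler_pdivrMr// mulrAC ler_pdivrMr// -(ler_pM2l d0).
  apply: (@le_trans _ _ (8 * (2 * e))).
    by have := ler_wpM2l (ler0n R 8) xl; lra.
  have -> : 8 * (2 * e) = 3 * (beta * c * (ln 2 * r) / 8) by rewrite /e; field.
  have -> : delta * (beta * (N%:R * c) * (ln 2 * r)) =
      (N%:R * (8 * delta)) * (beta * c * (ln 2 * r) / 8) by field.
  by apply: ler_wpM2r; rewrite ltW// divr_gt0// !mulr_gt0.
- apply: ler_wpM2r; first by rewrite exprn_ge0// expR_ge0.
  apply: ge0_ler_powR; rewrite ?nnegrE//.
  + by case/andP: rho01 => /ltW.
  + by rewrite divr_ge0// ltW.
  + rewrite card_prod card_bool card_ord.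
    have -> : (2 * N).-1%:R = 2 * N%:R - 1 :> R.
      by rewrite -subn1 natrB ?muln_gt0// natrM.
    have NE : N%:R <= 3 / (8 * delta) + 1 by rewrite /N -natr1 lerD2r.
    have dE : 3 / (8 * delta) = 3 / 8 / delta by field; rewrite gt_eqF.
    have d1 : 1 <= 40^-1 / delta by rewrite ler_pdivlMr// mul1r ltW.
    rewrite dE in NE; move: NE d1.
    have : 0 < delta^-1 by rewrite invr_gt0.
    lra.
Qed.
End random_coding.

(** * Slope of the exponent at rho = 0 *)

Section zero_rate_slope.
Context {R : realType}.
Variables (q a b : R).
Hypotheses (q01 : 0 < q < 1) (a0 : 0 <= a) (b0 : 0 <= b).

Let q0 : 0 < q. Proof. by case/andP: q01. Qed.
Let q1 : 0 < 1 - q. Proof. by rewrite subr_gt0; case/andP: q01. Qed.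
Let m := q * a + (1 - q) * b.

(** For [x >= 0] and [rho > 0] this is [x ^ (1 / (1 + rho))], rewritten so as to be differentiable
    at [rho = 0], also when [x = 0]. *)
Let term (x rho : R) : R := x * expR (((1 + rho)^-1 - 1) * ln x).
Let G (rho : R) : R := q * term a rho + (1 - q) * term b rho.
Let F (rho : R) : R := expR ((1 + rho) * ln (G rho)).

Let termE x rho : 0 <= x -> 0 < rho -> x `^ (1 + rho)^-1 = term x rho.
Proof.
rewrite /term le_eqVlt => /predU1P[<-|x0] r0.
  by rewrite mul0r powR0// invr_eq0 gt_eqF// addr_gt0.
rewrite /powR gt_eqF// mulrBl mul1r expRB lnK ?posrE//.
by field; rewrite gt_eqF.
Qed.

Let term0 x : term x 0 = x.
Proof. by rewrite /term addr0 invr1 subrr mul0r expR0 mulr1. Qed.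

Let term_ge0 x rho : 0 <= x -> 0 <= term x rho.
Proof. by move=> x0; rewrite mulr_ge0// expR_ge0. Qed.

Let is_derive_inv_shift : is_derive (0 : R) (1 : R) (fun rho => (1 + rho)^-1 - 1) (- 1).
Proof.
have d1 : is_derive (0 : R) (1 : R) (fun rho : R => 1 + rho) 1.
  by apply: is_derive_eq; rewrite /GRing.scale/=; ring.
have n0 : (fun rho : R => 1 + rho) 0 != 0 by rewrite /= addr0 oner_neq0.
have dV := is_deriveV n0 d1.
apply: is_derive_eq.
by rewrite addr0 expr1n invr1 oppr0 addr0 scaler1.
Qed.

Let is_derive_term x : is_derive (0 : R) (1 : R) (term x) (- (x * ln x)).
Proof.
have d1 : is_derive (0 : R) (1 : R) (fun rho : R => ((1 + rho)^-1 - 1) * ln x) (- ln x).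
  have := is_derive_inv_shift => ds.
  apply: is_derive_eq.
  by rewrite /GRing.scale/=; ring.
have d2 := is_derive1_comp (is_derive_expR _) d1.
have d3 : is_derive (0 : R) (1 : R)
   (fun rho : R => expR (((1 + rho)^-1 - 1) * ln x)) (- ln x).
  by apply: is_derive_eq; rewrite /= addr0 invr1 subrr mul0r expR0 mul1r.
apply: is_derive_eq.
by rewrite /GRing.scale/=; ring.
Qed.

Let is_derive_G : is_derive (0 : R) (1 : R) G
  (- (q * (a * ln a) + (1 - q) * (b * ln b))).
Proof.
have da := is_derive_term a; have db := is_derive_term b.
by apply: is_derive_eq; rewrite /GRing.scale/=; ring.
Qed.

Let is_derive_F : 0 < m -> is_derive (0 : R) (1 : R) F (- info_gap q a b).
Proof.
move=> m0.
have G0 : G 0 = m by rewrite /G !term0.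
have dln : is_derive (0 : R) (1 : R) (fun rho => ln (G rho))
    (m^-1 * - (q * (a * ln a) + (1 - q) * (b * ln b))).
  have Gp : 0 < G 0 by rewrite G0.
  have := is_derive1_comp (is_derive1_ln Gp) is_derive_G.
  by rewrite G0.
have d1 : is_derive (0 : R) (1 : R) (fun rho : R => (1 + rho) * ln (G rho))
    (ln m + m^-1 * - (q * (a * ln a) + (1 - q) * (b * ln b))).
  have d2 : is_derive (0 : R) (1 : R) (fun rho : R => 1 + rho) 1.
    by apply: is_derive_eq; rewrite /GRing.scale/=; ring.
  by apply: is_derive_eq; rewrite /GRing.scale/= G0; ring.
have := is_derive1_comp (is_derive_expR _) d1.
rewrite addr0 mul1r G0 lnK ?posrE// => dF.
apply: is_derive_eq.
by rewrite info_gapE -/m; field; rewrite gt_eqF.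
Qed.

(** At [rho = 0] the power mean is the arithmetic mean [m], and its derivative there is minus the
    Jensen gap. The case [m = 0] is kept apart because differentiating [ln (G rho)] needs [m > 0];
    both arguments then vanish. *)
Lemma power_mean_slope (u : nat -> R) :
  (forall n, 0 < u n) -> u n @[n --> \oo] --> 0 ->
  (m - power_mean q (u n) a b) / u n @[n --> \oo] --> info_gap q a b.
Proof.
move=> u0 cu.
have m_ge0 : 0 <= m by rewrite addr_ge0// mulr_ge0// ltW.
have GE rho : 0 < rho -> power_mean q rho a b = G rho `^ (1 + rho).
  by move=> r0; rewrite /power_mean !termE.
move: m_ge0; rewrite le_eqVlt => /predU1P[m0|m0].
  have [a_0 b_0] : a = 0 /\ b = 0.
    have h1 : 0 <= q * a by rewrite mulr_ge0// ltW.
    have h2 : 0 <= (1 - q) * b by rewrite mulr_ge0// ltW.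
    have /eqP : q * a = 0 by move: m0; rewrite /m; lra.
    have /eqP : (1 - q) * b = 0 by move: m0; rewrite /m; lra.
    by rewrite !mulf_eq0 (gt_eqF q0) (gt_eqF q1)/= => /eqP -> /eqP ->.
  rewrite info_gapE -/m -m0 a_0 b_0 !mul0r !mulr0 addr0 subr0.
  rewrite (_ : (fun n => _) = fun=> 0); first exact: cvg_cst.
  apply/funext => n; have un : 0 < 1 + u n by rewrite addr_gt0.
  rewrite /power_mean !powR0 ?invr_eq0 ?gt_eqF// !mulr0 addr0.
  by rewrite powR0 ?gt_eqF// subr0 mul0r.
have GF rho : 0 < rho -> power_mean q rho a b = F rho.
  move=> r0; rewrite GE// /powR ifF// gt_eqF//.
  have [ap|] := ltP 0 a.
    rewrite ltr_pwDl ?mulr_ge0 ?term_ge0 ?(ltW q1)// mulr_gt0// mulr_gt0// expR_gt0//.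
  move=> an; have a_0 : a = 0 by apply/eqP; rewrite eq_le an.
  have bp : 0 < b.
    move: m0; rewrite /m a_0 mulr0 add0r pmulr_rgt0//.
  by rewrite ltr_wpDl ?mulr_ge0 ?term_ge0 ?(ltW q0)// mulr_gt0// mulr_gt0// expR_gt0.
have F0 : F 0 = m by rewrite /F addr0 mul1r /G !term0 lnK.
have [dF DF] := is_derive_F m0.
have : h^-1 *: (F (h *: 1 + 0) - F 0) @[h --> 0^'] --> - info_gap q a b.
  by rewrite -DF; exact: dF.
move/cvg_dnbhs_at_right/cvg_at_rightP => /(_ u (conj u0 cu)) cF.
rewrite -[X in _ --> X]opprK; apply: cvg_trans (cvgN cF).
apply: near_eq_cvg; apply: nearW => n /=.
rewrite GF// F0 /GRing.scale/= fctE mulr1 addr0.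
by rewrite -mulrN opprB mulrC.
Qed.

End zero_rate_slope.

(** * Positive exponent and achievability below the information *)

Section achievability.
Context {R : realType} {d : measure_display} {Y : measurableType d}.
Variable mu : {sigma_finite_measure set Y -> \bar R}.
Variable W : R -> bool -> Y -> R.
Hypothesis WC : is_channel mu W.

(** If [E0 <= rho * r] for all [rho], then [1 - expR (- x) <= x] bounds the difference quotients of
    the Gallager integral by [ln 2 * r], and Fatou's lemma carries this over to [ln 2] times the
    information. The nonnegativity it asks for is [power_mean_le]. *)
Lemma E0_above_line (q r : R) : 0 < q < 1 ->
  (r%:E < mutual_info mu W q q)%E ->
  exists2 rho, 0 < rho < 1 & rho * r < E0 mu W rho q.
Proof.
move=> q01 rI; have l2 := @ln2_gt0 R.
have qq : 0 <= q <= 1 by case/andP: q01 => ? ?; rewrite !ltW.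
apply: contrapT => noex.
have E0r rho : 0 < rho < 1 -> E0 mu W rho q <= rho * r.
  by move=> rho01; rewrite leNgt; apply/negP => h; apply: noex; exists rho.
move: rI; apply/negP; rewrite -leNgt -(@lee_pmul2l _ (ln 2)%:E)//.
rewrite mutual_info_gap//.
pose u (n : nat) : R := n.+2%:R^-1.
have u0 n : 0 < u n by rewrite invr_gt0.
have u1 n : u n < 1 by rewrite invf_lt1// ltr1n.
have u01 n : 0 < u n < 1 by rewrite u0 u1.
have cu : u n @[n --> \oo] --> 0.
  by have := @cvg_harmonic R; rewrite -cvg_shiftS.
have W0 x y : 0 <= W q x y by exact: (channel_ge0 WC).
pose o y := output_density W q q y.
have mo : measurable_fun setT o by exact: (measurable_output_density WC).
have o1 : (\int[mu]_y (o y)%:E = 1)%E by exact: (integral_output_density WC).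
have mg n : measurable_fun setT (gmean W q (u n)) by exact: (measurable_gmean WC).
have go n y : gmean W q (u n) y <= o y.
  by rewrite /o output_densityE; apply: power_mean_le => //; exact: u0.
apply: (@fatou_le _ _ _ _ (fun n y => (o y - gmean W q (u n) y) / u n)).
- by move=> n; apply: measurable_funM => //; exact: measurable_funB.
- by move=> n y; rewrite divr_ge0 ?subr_ge0// ltW.
- move=> y; under eq_fun do rewrite /o output_densityE.
  exact: power_mean_slope.
move=> n.
under eq_integral do rewrite mulrC EFinM.
rewrite ge0_integralZl//; last 3 first.
- by apply/measurable_EFinP; exact: measurable_funB.
- by move=> y _; rewrite lee_fin subr_ge0.
- by rewrite lee_fin ltW// invr_gt0.
have gi : mu.-integrable setT (fun y => (gmean W q (u n) y)%:E).
  apply/integrableP; split; first exact/measurable_EFinP.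
  under eq_integral do rewrite /= ger0_norm ?gmean_ge0//.
  by rewrite (le_lt_trans (integral_gmean_le1 WC q01 (u01 n)))// ltry.
have oi : mu.-integrable setT (fun y => (o y)%:E).
  apply/integrableP; split; first exact/measurable_EFinP.
  under eq_integral do rewrite /= ger0_norm ?(output_density_ge0 WC)//.
  by rewrite o1 ltry.
under eq_integral do rewrite EFinB.
rewrite integralB//= o1 (E0_exp WC q01 (u01 n)) -EFinB -EFinM -EFinM lee_fin.
rewrite mulrC ler_pdivrMr//.
apply: (@le_trans _ _ (ln 2 * E0 mu W (u n) q)).
  by have := expR_ge1Dx (- (ln 2 * E0 mu W (u n) q)); lra.
by rewrite -mulrA ler_wpM2l ?(ltW l2)// mulrC E0r.
Qed.

Lemma cvg_geometric_comp (x : R) (k : nat) : 0 < x < 1 ->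
  x ^+ (n + k) @[n --> \oo] --> 0.
Proof.
case/andP=> x0 x1; rewrite (cvg_shiftn k (fun n => x ^+ n) (nbhs (0 : R))).
by apply: cvg_expr; rewrite ger0_norm// ltW.
Qed.

(** With [delta = 2 ^ (- r n)] the rate is exactly [r], and for the [rho] of [E0_above_line] the
    error decays as [z ^+ n] with [z < 1]. A constant factor is harmless here, so [beta = 1] is
    taken. *)
Lemma achievable_below (q r : R) : 0 < q < 1 -> 0 < r ->
  (r%:E < mutual_info mu W q q)%E -> achievable_rate mu W r.
Proof.
move=> q01 r0 rI; have l2 := @ln2_gt0 R.
have [rho rho01 Er0] := E0_above_line q01 rI.
have [rho0 rho1] := andP rho01.
have [delta0 d00 code] := random_coding WC q01 r0 (@ltr01 R).
pose x := expR (- (r * ln 2)).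
pose z := expR (- (ln 2 * (E0 mu W rho q - rho * r))).
have x01 : 0 < x < 1.
  by rewrite expR_gt0/= -[ltRHS]expR0 ltr_expR oppr_lt0 mulr_gt0.
have z01 : 0 < z < 1.
  by rewrite expR_gt0/= -[ltRHS]expR0 ltr_expR oppr_lt0 mulr_gt0// subr_gt0.
have [k0 xk0] : exists k0, forall n, (k0 <= n)%N -> x ^+ n < delta0.
  have cx : x ^+ n @[n --> \oo] --> 0.
    by apply: cvg_expr; case/andP: x01 => x0 x1; rewrite ger0_norm// ltW.
  have [k0 _ h] := cvgr_lt 0 cx _ d00.
  by exists k0 => n /h.
pose len k := (k + k0.+1)%N.
have lnx n : ln (x ^+ n) = - (n%:R * (r * ln 2)).
  by rewrite /x -expRM_natl expRK mulrN.
have xp n : 0 < x ^+ n by rewrite exprn_gt0//; case/andP: x01.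
have rate n : log2 (x ^+ n)^-1 = n%:R * r.
  by rewrite /log2 lnV ?posrE// lnx opprK mulrA mulfK// gt_eqF.
have S k : exists s : nonadaptive_strategy R Y, nqueries s = len k /\
    has_resolution mu W s (x ^+ len k) (expR 1 * z ^+ len k).
  have dk : 0 < x ^+ len k < delta0.
    by rewrite xp xk0// /len addnS -addSn leq_addl.
  have nE : (len k)%:R = log2 (x ^+ len k)^-1 / r by rewrite rate mulfK// gt_eqF.
  have [s sn sr] := code _ _ dk nE; exists s; split=> //.
  apply: has_resolution_le (sr _ rho01); apply: ler_wpM2l; first exact: expR_ge0.
  have -> : z ^+ len k = ((x ^+ len k)^-1) `^ rho *
      expR (- (ln 2 * E0 mu W rho q)) ^+ len k.
    rewrite /powR gt_eqF ?invr_gt0// lnV ?posrE// lnx opprK /z -!expRM_natl -expRD.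
    by congr expR; ring.
  apply: ler_wpM2r; first by rewrite exprn_ge0// expR_ge0.
  apply: ge0_ler_powR; rewrite ?nnegrE ?(ltW rho0)//.
  - by rewrite divr_ge0// ltW.
  - by rewrite invr_ge0 ltW.
  - by rewrite -[leRHS]mul1r ler_wpM2r// ?invr_ge0 ?(ltW (xp _))//; lra.
have [s sP] := choice S.
exists s, (fun k => x ^+ len k), (fun k => expR 1 * z ^+ len k); split.
- move=> k; have [sn sr] := sP k; rewrite sn; split => //.
    by rewrite /len addnS.
  by rewrite rate mulrC mulKf// pnatr_eq0 /len addnS.
- exact: cvg_geometric_comp.
- rewrite -[X in _ --> X](mulr0 (expR 1)); apply: cvgM; first exact: cvg_cst.
  exact: cvg_geometric_comp.
Qed.

End achievability.

(** * Exact exponent and assembly *)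

Section assembly.
Context {R : realType} {d : measure_display} {Y : measurableType d}.
Variable mu : {sigma_finite_measure set Y -> \bar R}.
Variable W : R -> bool -> Y -> R.
Hypothesis WC : is_channel mu W.

Lemma memoryless_prob_ge0 n (f : 'I_n -> Y -> R) A :
  (forall i y, 0 <= f i y) -> (0 <= memoryless_prob mu f A)%E.
Proof.
elim: n f A => [|n IH] f A f0 /=; first by rewrite lee_fin.
by apply: integral_ge0 => y _; rewrite mule_ge0 ?lee_fin// IH.
Qed.

Lemma success_prob_ge0 (s : nonadaptive_strategy R Y) delta w :
  (0 <= success_prob mu W s delta w)%E.
Proof.
apply: integral_ge0 => u _; apply: memoryless_prob_ge0 => i y.
by apply: (channel_ge0 WC); exact: query_size01.
Qed.

(** Otherwise a real rate strictly between the two sides would be achievable; it is positive because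
    0 belongs to the set defining the maximal rate. *)
Lemma achievability_le (q : R) : 0 < q < 1 ->
  (mutual_info mu W q q <= max_nonadaptive_rate mu W)%E.
Proof.
move=> q01; rewrite leNgt; apply/negP => lt.
have r0 : (0 <= max_nonadaptive_rate mu W)%E.
  by apply: ereal_sup_ubound; left.
have rf : max_nonadaptive_rate mu W \is a fin_num.
  by rewrite ge0_fin_numE// (lt_le_trans lt)// leey.
set m := fine (max_nonadaptive_rate mu W).
have mE : max_nonadaptive_rate mu W = m%:E by rewrite fineK.
have [r mr rI] : exists2 r : R, m < r & (r%:E < mutual_info mu W q q)%E.
  move: lt; rewrite mE; case: (mutual_info mu W q q) => [i| |//].
    by rewrite lte_fin => mi; exists ((m + i) / 2); rewrite ?lte_fin; lra.
  by move=> _; exists (m + 1); rewrite ?ltry//; lra.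
have m0 : 0 <= m by rewrite -lee_fin -mE.
have : (r%:E <= max_nonadaptive_rate mu W)%E.
  apply: ereal_sup_ubound; right; exists r => //.
  exact: (achievable_below WC q01 (le_lt_trans m0 mr) rI).
by rewrite mE lee_fin leNgt mr.
Qed.

(** The equality for [eps] leaves no constant to spare, so the loss of [random_coding] and that of a
    merely near-optimal [rho] are absorbed by [(4/5) ^ rho]. If [Er] is at most 0, the prescribed
    [eps] is at least 1 and the guarantee is trivial. *)
Lemma random_coding_exponent (q r : R) : 0 < q < 1 -> 0 < r ->
  exists2 delta0, 0 < delta0 & forall (n : nat) (delta : R),
    0 < delta < delta0 -> n%:R = log2 delta^-1 / r ->
    exists (s : nonadaptive_strategy R Y) (eps : R),
      [/\ nqueries s = n, 0 < eps, has_resolution mu W s delta eps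
        & log2 eps^-1 = Er mu W r q / r * log2 delta^-1].
Proof.
move=> q01 r0; have l2 := @ln2_gt0 R.
set E := Er mu W r q.
pose C := Num.max 1 (log2 (Num.min q (1 - q))^-1).
have C0 : 0 < C by rewrite /C lt_max ltr01.
have E0C rho : 0 < rho < 1 -> E0 mu W rho q <= rho * C.
  move=> rho01; apply: (le_trans (E0_le WC q01 rho01)).
  by rewrite ler_wpM2l ?le_max ?lexx ?orbT//; case/andP: rho01 => /ltW.
(* A near-optimal [rho] is at least [E / (2 C)], so [(4/5) ^ rho] is at most [expR (- 2 beta)]: one
   [beta] pays for the dependence between cells, the other for the distance to the supremum. *)
pose beta := if 0 < E then E / (2 * C) * ln (5 / 4) / 2 else 1.
have l54 : 0 < ln (5 / 4) :> R by rewrite ln_gt0//; lra.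
have beta0 : 0 < beta.
  rewrite /beta; case: ifP => // Ep.
  by rewrite !(divr_gt0, mulr_gt0).
have [delta0 d00 code] := random_coding WC q01 r0 beta0.
exists (Num.min delta0 1); first by rewrite lt_min d00 ltr01.
move=> n delta /andP[dp]; rewrite lt_min => /andP[dd d1] nE.
have ddelta : 0 < delta < delta0 by rewrite dp dd.
have [s sn sr] := code n delta ddelta nE.
pose x := E / r * log2 delta^-1.
have logE : log2 delta^-1 = n%:R * r by rewrite nE divfK// gt_eqF.
have xE : x = n%:R * E by rewrite /x logE; field; rewrite gt_eqF.
exists s, (expR (- (ln 2 * x))); split => //; first exact: expR_gt0.
  have [Ep|En] := ltP 0 E; last first.
    move=> w w01; apply: le_trans (success_prob_ge0 s delta w).
    rewrite lee_fin subr_le0 -[leLHS]expR0 ler_expR oppr_ge0 xE.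
    by rewrite mulr_ge0_le0 ?(ltW l2)// mulr_ge0_le0.
  have betaE : beta = E / (2 * C) * ln (5 / 4) / 2 by rewrite /beta Ep.
  (* The first term yields the lower bound on [rho]; the second keeps the total loss
     [ln 2 * n * eta] below [beta]. *)
  pose eta := Num.min (E / 2) (beta / (ln 2 * n.+1%:R)).
  have eta0 : 0 < eta by rewrite lt_min !divr_gt0// mulr_gt0.
  have sup_E : has_sup [set E0 mu W rho q - rho * r | rho in `]0, 1[].
    split; first by exists (E0 mu W 2^-1 q - 2^-1 * r); exists 2^-1 => //=;
      rewrite in_itv/=; apply/andP; split; lra.
    exists C => _ [rho /= rho_itv <-].
    have rho01 : 0 < rho < 1 by move: rho_itv; rewrite in_itv.
    have /andP[rho0 rho1] := rho01; have := E0C _ rho01.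
    have : rho * C <= 1 * C by rewrite ler_wpM2r ?ltW.
    have : 0 <= rho * r by rewrite mulr_ge0 ?ltW.
    lra.
  have [_ [rho /= rho01 <-]] := sup_adherent eta0 sup_E.
  move: rho01; rewrite in_itv/= -/(Er mu W r q) -/E => rho01 Eeta.
  have /andP[rho0 rho1] := rho01.
  have eta1 : eta <= E / 2 by rewrite ge_min lexx.
  have eta2 : ln 2 * n%:R * eta <= beta.
    apply: (@le_trans _ _ (ln 2 * n.+1%:R * eta)).
      by rewrite ler_wpM2r ?(ltW eta0)// ler_wpM2l ?(ltW l2)// ler_nat.
    rewrite mulrC -ler_pdivlMr ?mulr_gt0//.
    by rewrite ge_min lexx orbT.
  (* [E / 2 <= E - eta < E0 - rho * r <= rho * C]. *)
  have rhoC : E / (2 * C) <= rho.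
    rewrite ler_pdivrMr ?mulr_gt0//; have := E0C _ rho01.
    have : 0 <= rho * r by rewrite mulr_ge0 ?ltW.
    lra.
  have rl : 2 * beta <= rho * ln (5 / 4).
    rewrite betaE.
    have := ler_wpM2r (ltW l54) rhoC; lra.
  apply: has_resolution_le (sr _ rho01).
  have pE : (4 / 5 / delta) `^ rho = expR (rho * (- ln (5 / 4) + ln 2 * (n%:R * r))).
    rewrite /powR gt_eqF ?divr_gt0//; congr expR; congr (_ * _).
    have -> : 4 / 5 / delta = (5 / 4)^-1 * delta^-1 by field; rewrite gt_eqF.
    rewrite lnM ?posrE ?invr_gt0// lnV ?posrE//; congr (_ + _).
    by rewrite -logE /log2 mulrC divfK// gt_eqF.
  rewrite pE -expRM_natl -!expRD ler_expR xE.
  have : ln 2 * n%:R * (E - eta) <= ln 2 * n%:R * (E0 mu W rho q - rho * r).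
    by rewrite ler_wpM2l ?mulr_ge0 ?(ltW l2)// ltW.
  lra.
rewrite /log2 lnV ?posrE ?expR_gt0// expRK opprK [ln 2 * _]mulrC.
by rewrite mulfK// gt_eqF.
Qed.

End assembly.

Theorem theorem1 (R : realType) (d : measure_display) (Y : measurableType d)
    (mu : {sigma_finite_measure set Y -> \bar R})
    (W : R -> bool -> Y -> R)
    (W_channel : is_channel mu W)
    (W_cont : forall x y, {within `[0, 1], continuous (fun q => W q x y)})
    (C1_fin : forall q, 0 <= q <= 1 -> (C1 mu W q < +oo)%E)
    (C_mono : forall q1 q2, 0 <= q1 -> q1 < q2 -> q2 <= 1 ->
       (capacity mu W q2 <= capacity mu W q1)%E)
    (C1_mono : forall q1 q2, 0 <= q1 -> q1 < q2 -> q2 <= 1 ->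
       (C1 mu W q2 <= C1 mu W q1)%E) :
  let Imax := ereal_sup [set mutual_info mu W q q | q in `]0, 2^-1[] in
  [/\ (Imax <= max_nonadaptive_rate mu W)%E,
      (forall q, 2^-1 < q < 1 -> (mutual_info mu W q q <= Imax)%E) ->
        max_nonadaptive_rate mu W = Imax
    & forall qs, 0 < qs < 2^-1 ->
        (forall q, 0 < q < 2^-1 ->
           (mutual_info mu W q q <= mutual_info mu W qs qs)%E) ->
        forall r, 0 < r -> (r%:E < max_nonadaptive_rate mu W)%E ->
        exists2 delta0, 0 < delta0 &
          forall (n : nat) (delta : R), 0 < delta < delta0 ->
            n%:R = log2 delta^-1 / r ->
            exists (s : nonadaptive_strategy R Y) (eps : R),
              [/\ nqueries s = n, 0 < eps, has_resolution mu W s delta eps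
                & log2 eps^-1 = Er mu W r qs / r * log2 delta^-1]].
Proof.
move=> Imax.
have half01 (q : R) : 0 < q < 2^-1 -> 0 < q < 1.
  by move=> /andP[q0 q1]; apply/andP; split; lra.
have lower : (Imax <= max_nonadaptive_rate mu W)%E.
  apply: ge_ereal_sup => _ [q /= q_itv <-].
  apply: achievability_le => //; apply: half01.
  by move: q_itv; rewrite in_itv.
split=> // [upper|qs qs01 _ r r0 _]; last first.
  exact: (random_coding_exponent W_channel (half01 _ qs01) r0).
apply/eqP; rewrite eq_le lower andbT.
have Isup q : 0 < q < 2^-1 -> (mutual_info mu W q q <= Imax)%E.
  by move=> q01; apply: ereal_sup_ubound; exists q => //=; rewrite in_itv.
(* At most [1 / 3], so that [u], [1 - u] and [1 / 2 - u] stay in the open ranges where the bound is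
   known. *)
pose u (k : nat) : R := k.+3%:R^-1.
have u0 k : 0 < u k by rewrite invr_gt0.
have u1 k : u k <= 3^-1 by rewrite lef_pV2 ?posrE// ler_nat.
have cu : u k @[k --> \oo] --> 0.
  by have := @cvg_harmonic R; rewrite -cvg_shiftS -cvg_shiftS.
have Iall q : 0 <= q <= 1 -> (mutual_info mu W q q <= Imax)%E.
  case/andP; rewrite le_eqVlt => /predU1P[<- _|q0].
    apply: (mutual_info_lsc W_channel W_cont (q := u)) => //.
    - by move=> k; have := u0 k; have := u1 k => h1 h2; apply/andP; split; lra.
    - by rewrite lexx ler01.
    - by move=> k; apply: Isup; have := u0 k; have := u1 k => h1 h2;
        apply/andP; split; lra.
  rewrite le_eqVlt => /predU1P[->|q1].
    apply: (mutual_info_lsc W_channel W_cont (q := fun k => 1 - u k)) => //.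
    - by move=> k; have := u0 k; have := u1 k => h1 h2; apply/andP; split; lra.
    - by rewrite lexx ler01.
    - by rewrite -[X in _ --> X]subr0; apply: cvgB => //; exact: cvg_cst.
    - by move=> k; apply: upper; have := u0 k; have := u1 k => h1 h2;
        apply/andP; split; lra.
  have [qh|qh|->] := ltgtP q 2^-1.
  - by apply: Isup; rewrite q0 qh.
  - by apply: upper; rewrite qh q1.
  - apply: (mutual_info_lsc W_channel W_cont (q := fun k => 2^-1 - u k)) => //.
    - by move=> k; have := u0 k; have := u1 k => h1 h2; apply/andP; split; lra.
    - by apply/andP; split; lra.
    - by rewrite -[X in _ --> X]subr0; apply: cvgB => //; exact: cvg_cst.
    - by move=> k; apply: Isup; have := u0 k; have := u1 k => h1 h2;
        apply/andP; split; lra.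
(* The maximal rate is at least 0 by convention, and [converse_rate] asks for a nonnegative
   bound. *)
have Imax0 : (0 <= Imax)%E.
  have q4 : 0 < (4^-1 : R) < 2^-1 by apply/andP; split; lra.
  apply: le_trans (Isup _ q4).
  by apply: (mutual_info_ge0 W_channel); apply/andP; split; lra.
have [->|Ify] := eqVneq Imax +oo%E; first by rewrite leey.
have If : Imax \is a fin_num by rewrite ge0_fin_numE// lt_neqAle Ify leey.
apply: ge_ereal_sup => _ [->//|[r ar <-]].
rewrite -(fineK If) lee_fin; apply: (converse_rate W_channel W_cont _ _ ar).
  exact: fine_ge0.
by move=> q q01; rewrite fineK// Iall.
Qed.
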